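(* Let $\nu\ge1$ be an integer, $u>0$, $\mathscr V(z;u)=\frac{z^2}{2}+u\frac{z^{2\nu}}{2\nu}$, and define the eigenvalue partition function $\mathcal Z_{nN}(u)=\int_{\mathbb R^n}\prod_{1\le j<k\le n}(z_j-z_k)^2\prod_{j=1}^n e^{-N\mathscr V(z_j;u)}\,dz_1\cdots dz_n$ and the free energy $\mathcal F_{nN}(u)=\frac1{n^2}\ln\frac{\mathcal Z_{nN}(u)}{\mathcal Z_{nN}(0)}$. Let $x=n/N$ and let $\mathcal F_{nN}\sim\sum_{g=0}^\infty f_{2g}(x;u)N^{-2g}$ ($N\to\infty$) be its topological expansion, with $f_{2g}$ analytic near $(x,u)=(1,0)$. Write $f_{2g}(x;u)=\sum_{j=0}^\infty\alpha_{2g,j}(x)u^j$. Then $\alpha_{2g,j}(x)=\tilde c_{2g,j}\,x^{\widetilde{\mathscr D}}$ for a constant $\tilde c_{2g,j}$, where $\widetilde{\mathscr D}=j(\nu-1)-2g$. Moreover, if $\widetilde{\mathscr D}<-2$ then $\alpha_{2g,j}(x)=\tilde c_{2g,j}=0$.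
   Context: The existence of the topological expansion of $\mathcal F_{nN}$ in powers of $N^{-2}$, valid for $x$ near $1$ and small $u$, with coefficients $f_{2g}(x;u)$ analytic near $(1,0)$, is taken as known. *)

(* Defs.v *)
From HB Require Import structures.
From mathcomp Require Import all_boot all_order all_algebra.
From mathcomp Require Import all_classical all_reals all_analysis.

Set Implicit Arguments.
Unset Strict Implicit.
Unset Printing Implicit Defensive.

Import Order.TTheory GRing.Theory Num.Theory.
Import numFieldNormedType.Exports.

Local Open Scope classical_set_scope.
Local Open Scope ring_scope.

(* The image of m1 \x m under (z, t) |-> z :: t. *)
Section cons_measure.
Context (d : measure_display) (T : measurableType d) (R : realType) (n : nat).
Variable m1 : {sigma_finite_measure set T -> \bar R}.
Variable m : {sigma_finite_measure set (n.-tuple T) -> \bar R}.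

Definition consp (p : T * n.-tuple T) : n.+1.-tuple T :=
  [the n.+1.-tuple T of p.1 :: p.2].

Lemma measurable_consp : measurable_fun setT consp.
Proof. exact: measurable_cons. Qed.

Definition cons_measure : set (n.+1.-tuple T) -> \bar R :=
  pushforward (m1 \x m)%E consp.

Let cons_measure0 : cons_measure set0 = 0%E.
Proof. by rewrite /cons_measure /pushforward preimage_set0 measure0. Qed.

Let cons_measure_ge0 A : (0 <= cons_measure A)%E.
Proof. by rewrite /cons_measure /pushforward; exact: measure_ge0. Qed.

Let cons_measure_sigma_additive : semi_sigma_additive cons_measure.
Proof.
move=> F mF tF mUF; rewrite /cons_measure /pushforward preimage_bigcup.
apply: measure_semi_sigma_additive.
- by move=> i; rewrite -[X in measurable X]setTI; exact: measurable_consp.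
- apply/trivIsetP => /= i j _ _ ij; rewrite -preimage_setI.
  by move/trivIsetP : tF => /(_ _ _ _ _ ij) ->//; rewrite preimage_set0.
- rewrite -preimage_bigcup -[X in measurable X]setTI.
  exact: measurable_consp.
Qed.

HB.instance Definition _ := isMeasure.Build _ _ _ cons_measure
  cons_measure0 cons_measure_ge0 cons_measure_sigma_additive.

Let cons_measure_sigma_finite : sigma_finite setT cons_measure.
Proof.
have /sigma_finiteP[F [TF ndF Foo]] := sigma_finiteT m1.
have /sigma_finiteP[G [TG ndG Goo]] := sigma_finiteT m.
pose h (t : n.+1.-tuple T) : T * n.-tuple T := (thead t, [tuple of behead t]).
have mh : measurable_fun setT h.
  apply: measurable_fun_pair; first exact: measurable_tnth.
  exact: measurable_behead.
have hK : cancel consp h.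
  by case=> x t; rewrite /h /consp /= theadE; congr pair; exact: val_inj.
exists (fun i => h @^-1` (F i `*` G i)).
  rewrite -preimage_bigcup (_ : \bigcup_i _ = setT) ?preimage_setT//.
  rewrite -setXTT TF TG predeqE => -[x y]; split.
    by move=> [i _ []/= ? ?]; split; exists i.
  move=> [/= [i _ Fix] [k _ Gky]]; exists (maxn i k) => //; split.
  - by move: x Fix; exact/subsetPset/ndF/leq_maxl.
  - by move: y Gky; exact/subsetPset/ndG/leq_maxr.
move=> i; have [mF Fi] := Foo i; have [mG Gi] := Goo i; split.
  by rewrite -[X in measurable X]setTI; apply: mh => //; exact: measurableX.
rewrite /cons_measure /pushforward -comp_preimage.
rewrite (_ : h \o consp = id) ?preimage_id; last first.
  by apply/funext => p; exact: hK.
by rewrite product_measure1E// lte_mul_pinfty// ge0_fin_numE.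
Qed.

HB.instance Definition _ := Measure_isSigmaFinite.Build _ _ _ cons_measure
  cons_measure_sigma_finite.

End cons_measure.

(* Lebesgue measure on R^n, with R^n represented by [n.-tuple R]. *)
Fixpoint lebesgue_tuple (R : realType) (n : nat) :
    {sigma_finite_measure set (n.-tuple (measurableTypeR R)) -> \bar R} :=
  match n with
  | 0 => \d_([tuple] : 0.-tuple (measurableTypeR R))
  | n'.+1 => cons_measure (@lebesgue_measure R) (lebesgue_tuple R n')
  end.

Section matrix_model.
Context (R : realType) (nu : nat).

Definition potential (z u : R) : R :=
  z ^+ 2 / 2 + u * (z ^+ (2 * nu) / (2 * nu)%:R).

Definition partition_function (n N : nat) (u : R) : R :=
  \int[lebesgue_tuple R n]_z
    ((\prod_(j < n) \prod_(k < n | (j < k)%N) (tnth z j - tnth z k) ^+ 2) *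
     \prod_(j < n) expR (- (N%:R * potential (tnth z j) u))).

Definition free_energy (n N : nat) (u : R) : R :=
  (n%:R ^+ 2)^-1 * ln (partition_function n N u / partition_function n N 0).

(* [f g] stands for the coefficient f_{2g} of N^(-2g).  The remainder estimate
   is uniform for n/N near 1 and small u > 0; the neighbourhood and the
   constant may depend on the order K of truncation. *)
Definition topological_expansion (f : nat -> R -> R -> R) : Prop :=
  forall K : nat, exists (eps del C : R) (N0 : nat),
    [/\ 0 < eps, 0 < del &
     forall (n N : nat) (u : R), (0 < n)%N -> (0 < N)%N -> (N0 <= N)%N ->
       `|n%:R / N%:R - 1| < eps -> 0 < u < del ->
       `|free_energy n N u -
           \sum_(g < K.+1) f g (n%:R / N%:R) u / N%:R ^+ (2 * g)|
         <= C / N%:R ^+ (2 * K.+1)].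

Definition scaling_exponent (g j : nat) : int :=
  j%:Z * (nu%:Z - 1) - 2 * g%:Z.

End matrix_model.

(* f is the sum of an absolutely convergent double power series centred at
   (x0, u0) on the box |x - x0| < rho, |u - u0| < delta. *)
Definition analytic_on_box (R : realType) (f : R -> R -> R)
    (x0 u0 rho delta : R) : Prop :=
  exists a : nat -> nat -> R, forall x u : R,
    `|x - x0| < rho -> `|u - u0| < delta ->
    let t k l := a k l * (x - x0) ^+ k * (u - u0) ^+ l in
    summable [set: nat * nat] (fun p => (t p.1 p.2)%:E) /\
    (\sum_(k < m) \sum_(l < m) t k l) @[m --> \oo] --> f x u.

(* Main.v *)
Require Import Defs.
From HB Require Import structures.
From mathcomp Require Import all_boot all_order all_algebra.
From mathcomp Require Import ring lra zify.
From mathcomp Require mpoly.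

(** Write [Q = \sum_i z_i ^ (2 nu) / (2 nu)].  Integration by parts against the
    Gaussian weight [exp (- N z^2 / 2)] gives loop equations that express the
    moments of power sums under the Gaussian ensemble through moments of lower
    total degree; hence the expectation of [(N u Q)^j] equals [t^j m_j(n)] with
    [t = u / N^(nu-1)] and [m_j] a polynomial.  Taylor's formula for [exp] and
    [ln] turns this into an expansion of [n^2 F_{nN}(u)] in powers of [t] with
    coefficients [P_j(n)] polynomial in [n] and a remainder that is polynomially
    bounded in [n].  Comparing it with the topological expansion along
    [n = (k + 2) m], [N = (k + 1) m], [m -> oo], with [u] a small power of [1 / m],
    identifies [alpha_{2g,j}(x)] for [x = 1 + 1 / (k + 1)] and large [k] as the
    coefficient of [n^(D + 2)] in [P_j] times [x^D], where [D = j (nu - 1) - 2 g].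
    This coefficient vanishes when [D + 2 < 0].  Since [alpha_{2g,j}] is given by
    a power series at [1], the identity extends from the points [1 + 1 / (k + 1)]
    to the whole interval. *)

Set Implicit Arguments.
Unset Strict Implicit.
Unset Printing Implicit Defensive.

Import Order.TTheory GRing.Theory Num.Theory.
Local Open Scope ring_scope.

(** * Loop equations *)

Definition sqr_vandermonde (R : comNzRingType) n (v : 'I_n -> R) : R :=
  \prod_(j < n) \prod_(k < n | (j < k)%N) (v j - v k) ^+ 2.

Section loop_equations.
Import mpoly.

Lemma mderivU (R : comNzRingType) n (i j : 'I_n) :
  ('X_i : {mpoly R[n]})^`M(j) = (i == j)%:R.
Proof.
rewrite mderivX mnm1E; case: eqVneq => [->|_]; last by rewrite scale0r.
by rewrite scale1r -[X in (X - _)%MM]add0m addmK mpolyX0.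
Qed.

Lemma mderiv_exp (R : comNzRingType) n (i : 'I_n) (p : {mpoly R[n]}) m :
  (p ^+ m)^`M(i) = m%:R * p ^+ m.-1 * p^`M(i).
Proof.
elim: m => [|m ih]; first by rewrite expr0 -mpolyC1 mderivC !mul0r.
rewrite exprS mderivM ih; case: m {ih} => [|m]; first by rewrite /=; ring.
by rewrite /= exprS -[in RHS]natr1; ring.
Qed.

Definition power_sum {R : comNzRingType} n k : {mpoly R[n]} :=
  \sum_(i < n) 'X_i ^+ k.

Definition power_sum_prod {R : comNzRingType} n (s : seq nat) : {mpoly R[n]} :=
  \prod_(m <- s) power_sum n m.

Definition msqr_vandermonde {R : comNzRingType} n : {mpoly R[n]} :=
  sqr_vandermonde (fun i => 'X_i).

Section vector_field.
Context {R : comNzRingType} {n : nat}.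
Implicit Types p q : {mpoly R[n]}.

Definition vector_field k p := \sum_(i < n) 'X_i ^+ k * p^`M(i).

Lemma vector_field_is_linear k : linear (vector_field k).
Proof.
move=> c p q; rewrite /vector_field scaler_sumr -big_split.
by apply: eq_bigr => i _; rewrite linearP mulrDr scalerAr.
Qed.

HB.instance Definition _ k := GRing.isLinear.Build R {mpoly R[n]} {mpoly R[n]}
  *:%R (vector_field k) (vector_field_is_linear k).

Lemma vector_fieldM k p q :
  vector_field k (p * q) = vector_field k p * q + p * vector_field k q.
Proof.
rewrite /vector_field mulr_suml mulr_sumr -big_split.
by apply: eq_bigr => i _; rewrite mderivM /=; ring.
Qed.

Lemma vector_field1 k : vector_field k 1 = 0.
Proof. by rewrite /vector_field big1// => i _; rewrite -mpolyC1 mderivC mulr0. Qed.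

Lemma vector_fieldX k i : vector_field k 'X_i = 'X_i ^+ k.
Proof.
rewrite /vector_field (bigD1 i)//= big1 => [|j ji].
  by rewrite addr0 mderivU eqxx mulr1.
by rewrite mderivU eq_sym (negbTE ji) mulr0.
Qed.

Lemma vector_field_exp k p m :
  vector_field k (p ^+ m) = m%:R * p ^+ m.-1 * vector_field k p.
Proof.
rewrite /vector_field mulr_sumr; apply: eq_bigr => i _.
by rewrite mderiv_exp; ring.
Qed.

Lemma vector_field_prod_eigen k I (r : seq I) (P : pred I)
    (F c : I -> {mpoly R[n]}) :
  (forall i, P i -> vector_field k (F i) = F i * c i) ->
  vector_field k (\prod_(i <- r | P i) F i) =
  (\prod_(i <- r | P i) F i) * \sum_(i <- r | P i) c i.
Proof.
move=> Fc; elim/big_rec2: _ => [|i s p Pi ih]; first by rewrite vector_field1 mulr0.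
by rewrite vector_fieldM ih Fc//; ring.
Qed.

Lemma power_sum0 : power_sum n 0 = n%:R :> {mpoly R[n]}.
Proof.
rewrite /power_sum (eq_bigr (fun=> 1)) => [|i _]; last by rewrite expr0.
by rewrite sumr_const card_ord.
Qed.

Lemma vector_field_power_sum k m :
  vector_field k (power_sum n m) = m%:R * power_sum n (m.-1 + k).
Proof.
rewrite /power_sum linear_sum mulr_sumr; apply: eq_bigr => i _ /=.
by rewrite vector_field_exp vector_fieldX exprD; ring.
Qed.

Lemma power_sum_prod_cons m s :
  power_sum_prod n (m :: s) = power_sum n m * power_sum_prod n s :> {mpoly R[n]}.
Proof. by rewrite /power_sum_prod big_cons. Qed.

Lemma vector_field_power_sum_prod k s :
  vector_field k (power_sum_prod n s) =
  \sum_(i < size s) (nth 0%N s i)%:R *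
     power_sum_prod n ((nth 0%N s i).-1 + k :: take i s ++ drop i.+1 s)%N.
Proof.
elim: s => [|m s ih]; first by rewrite /power_sum_prod big_nil vector_field1 big_ord0.
rewrite power_sum_prod_cons vector_fieldM ih vector_field_power_sum.
rewrite [RHS](@big_ord_recl _ _ _ (size s)) take0 cat0s drop1.
rewrite power_sum_prod_cons mulrA.
congr (_ + _); rewrite mulr_sumr; apply: eq_bigr => i _ /=.
by rewrite !power_sum_prod_cons; ring.
Qed.

Definition divided_difference k (i j : 'I_n) : {mpoly R[n]} :=
  \sum_(l < k) 'X_i ^+ (k.-1 - l) * 'X_j ^+ l.

Lemma divided_differenceC k i j :
  divided_difference k i j = divided_difference k j i.
Proof.
rewrite /divided_difference (reindex_inj rev_ord_inj)/=.
apply: eq_bigr => l _; rewrite mulrC.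
have lk := ltn_ord l.
by congr (_ ^+ _ * _ ^+ _); lia.
Qed.

Lemma divided_difference_diag k i : divided_difference k i i = ('X_i ^+ k)^`M(i).
Proof.
rewrite mderiv_exp mderivU eqxx mulr1 /divided_difference.
rewrite (eq_bigr (fun=> 'X_i ^+ k.-1)) ?sumr_const ?card_ord ?mulr_natl// => l _.
by rewrite -exprD; congr (_ ^+ _); have := ltn_ord l; lia.
Qed.

Lemma sum_divided_difference k :
  \sum_(i < n) \sum_(j < n) divided_difference k i j =
  \sum_(l < k) power_sum n (k.-1 - l) * power_sum n l :> {mpoly R[n]}.
Proof.
rewrite /divided_difference.
under eq_bigr do rewrite exchange_big.
rewrite exchange_big/=; apply: eq_bigr => l _.
by rewrite big_distrlr.
Qed.

Lemma vector_field_msqr_vandermonde k :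
  vector_field k (msqr_vandermonde n) = msqr_vandermonde n *
    \sum_(i < n) \sum_(j < n | j != i) divided_difference k i j.
Proof.
rewrite /msqr_vandermonde /sqr_vandermonde.
rewrite (@vector_field_prod_eigen k _ _ _ _ (fun i : 'I_n =>
  \sum_(j < n | (i < j)%N) (divided_difference k i j + divided_difference k i j))).
  congr (_ * _).
  under eq_bigr do rewrite big_split.
  rewrite big_split/=.
  rewrite [X in _ + X](exchange_big_dep predT)//= -big_split/=.
  apply: eq_bigr => i _.
  under [X in _ + X]eq_bigr do rewrite divided_differenceC.
  rewrite [RHS](bigID (fun j : 'I_n => (i < j)%N))/=.
  by congr (_ + _); apply: eq_bigl => j; rewrite -(inj_eq val_inj)/=; lia.
move=> i _; apply: vector_field_prod_eigen => j _.
rewrite vector_field_exp linearB /= !vector_fieldX subrXX.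
by rewrite -/(divided_difference k i j); ring.
Qed.

End vector_field.

Section loop_equation.
Context (R : comNzRingType) (n : nat).

Definition gaussian_functional (a : R) (G : {linear {mpoly R[n]} -> R^o}) :=
  forall i p, a * G ('X_i * p) = G p^`M(i).

Context (a : R) (G : {linear {mpoly R[n]} -> R^o}).
Hypothesis gaussG : gaussian_functional a G.

Lemma loop_equation k q :
  a * G (power_sum n k.+1 * q * msqr_vandermonde n) =
  \sum_(l < k) G (power_sum n (k.-1 - l) * power_sum n l * q * msqr_vandermonde n) +
  G (vector_field k q * msqr_vandermonde n).
Proof.
have -> : a * G (power_sum n k.+1 * q * msqr_vandermonde n) =
    G (\sum_(i < n) ('X_i ^+ k * (q * msqr_vandermonde n))^`M(i)).
  rewrite /power_sum -mulrA mulr_suml !linear_sum mulr_sumr.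
  by apply: eq_bigr => i _; rewrite -gaussG exprS !mulrA.
rewrite -linear_sum -linearD; congr (G _); rewrite -!mulr_suml.
under eq_bigr do rewrite mderivM -divided_difference_diag.
rewrite big_split/= -mulr_suml -/(vector_field k (q * msqr_vandermonde n)).
rewrite vector_fieldM vector_field_msqr_vandermonde -sum_divided_difference.
have -> : \sum_(i < n) \sum_(j < n) @divided_difference R n k i j =
    \sum_(i < n) divided_difference k i i +
    \sum_(i < n) \sum_(j < n | j != i) divided_difference k i j.
  by rewrite -big_split; apply: eq_bigr => i _; rewrite (bigD1 i).
by ring.
Qed.

End loop_equation.

Section polynomial_moment.
Context {R : comNzRingType}.

Definition polynomial_moment e (F : forall n, {mpoly R[n]}) :=
  exists P : {poly R}, forall n a G, gaussian_functional (n := n) a G ->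
    a ^+ e * G (F n * msqr_vandermonde n) = P.[n%:R] * G (msqr_vandermonde n).

Lemma eq_polynomial_moment e F1 F2 : (forall n, F1 n = F2 n) ->
  polynomial_moment e F1 -> polynomial_moment e F2.
Proof. by move=> F12 [P momentE]; exists P => n a G gaussG; rewrite -F12 momentE. Qed.

Lemma polynomial_moment1 : polynomial_moment 0 (fun=> 1).
Proof. by exists 1 => n a G _; rewrite hornerC mul1r. Qed.

Lemma polynomial_momentMn e F m :
  polynomial_moment e F -> polynomial_moment e (fun n => m%:R * F n).
Proof.
move=> [P momentE]; exists (P *+ m) => n a G gaussG.
by rewrite mulr_natl mulrnAl raddfMn hornerMn !mulrnAl mulrnAr momentE.
Qed.

Lemma polynomial_moment_power_sum0 e F :
  polynomial_moment e F -> polynomial_moment e (fun n => power_sum n 0 * F n).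
Proof.
move=> [P momentE]; exists ('X * P) => n a G gaussG.
rewrite power_sum0 mulr_natl mulrnAl raddfMn mulrnAr momentE//.
by rewrite hornerM hornerX -mulrA mulr_natl.
Qed.

Lemma polynomial_momentD e F1 F2 :
  polynomial_moment e F1 -> polynomial_moment e F2 ->
  polynomial_moment e (fun n => F1 n + F2 n).
Proof.
move=> [P1 momentE1] [P2 momentE2]; exists (P1 + P2) => n a G gaussG.
by rewrite mulrDl linearD mulrDr momentE1// momentE2// hornerD mulrDl.
Qed.

Lemma polynomial_moment_sum e (I : finType) (F : I -> forall n, {mpoly R[n]}) :
  (forall i, polynomial_moment e (F i)) ->
  polynomial_moment e (fun n => \sum_i F i n).
Proof.
move=> momentF; have [P momentE] := @fin_all_exists _ (fun=> {poly R})
  (fun i P => forall n a G, gaussian_functional (n := n) a G -> _ = P.[n%:R] * _) momentF.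
exists (\sum_i P i) => n a G gaussG.
rewrite mulr_suml linear_sum mulr_sumr horner_sum mulr_suml.
by apply: eq_bigr => i _; exact: momentE.
Qed.

Lemma polynomial_moment_power_sumS e k s :
  (forall l : 'I_k, polynomial_moment e (fun n =>
     power_sum_prod n [:: (k.-1 - l)%N, nat_of_ord l & s])) ->
  polynomial_moment e (fun n => vector_field k (power_sum_prod n s)) ->
  polynomial_moment e.+1 (fun n => power_sum_prod n (k.+1 :: s)).
Proof.
move=> /polynomial_moment_sum moment_sum /(polynomial_momentD moment_sum)[P momentE].
exists P => n a G gaussG; rewrite -(momentE n a G gaussG).
rewrite power_sum_prod_cons exprSr -mulrA.
rewrite (loop_equation gaussG) mulrDl linearD.
congr (_ * (_ + _)); rewrite mulr_suml linear_sum; apply: eq_bigr => l _.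
by rewrite !power_sum_prod_cons !mulrA.
Qed.

(* Each loop equation removes one power of [a] and lowers the total degree by
   two; [power_sum 0] costs a factor [n], hence the weight of the induction. *)
Lemma power_sum_prod_polynomial_moment s :
  polynomial_moment (uphalf (sumn s)) (fun n => power_sum_prod n s).
Proof.
have [d] := ubnP (2 * sumn s + size s)%N.
elim: d s => // d ih [|[|k] s] sd.
- by apply: eq_polynomial_moment polynomial_moment1 => n; rewrite /power_sum_prod big_nil.
- have [|P momentE] := polynomial_moment_power_sum0 (ih s _).
    by move: sd => /=; lia.
  by exists P => n a G gaussG; rewrite power_sum_prod_cons momentE.
have lower t : (sumn t).+1 = (k + sumn s)%N -> (size t <= (size s).+2)%N ->
    polynomial_moment (k + sumn s)./2 (fun n => power_sum_prod n t).
  by move=> ts st; rewrite -ts; apply: ih; move: sd => /=; lia.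
apply: polynomial_moment_power_sumS => [l|].
  by apply: lower => //=; have := ltn_ord l; lia.
apply: eq_polynomial_moment (fun n => esym (vector_field_power_sum_prod k s)) _.
apply: polynomial_moment_sum => i; set t := take i s ++ drop i.+1 s.
have st : sumn s = (sumn t + nth 0%N s i)%N.
  by rewrite -{1}(cat_take_drop i s) (drop_nth 0%N)// !sumn_cat/=; lia.
have [si0|si_gt0] := posnP (nth 0%N s i).
  by rewrite si0; exists 0 => n a G _; rewrite !mul0r linear0 mulr0 horner0 mul0r.
apply/polynomial_momentMn/lower => /=; first by lia.
by rewrite size_cat size_take size_drop ltn_ord; have := ltn_ord i; lia.
Qed.

End polynomial_moment.

Section moment_functional.
Context (R : comNzRingType) (n : nat) (g : nat -> R).

Definition moment_functional (p : {mpoly R[n]}) : R^o :=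
  \sum_(m <- msupp p) p@_m * \prod_(i < n) g (m i).

Lemma moment_functionalwE p k : (msize p <= k)%N ->
  moment_functional p =
  \sum_(m : 'X_{1..n < k}) p@_m * \prod_(i < n) g ((m : 'X_{1..n}) i).
Proof.
move=> pk; rewrite /moment_functional.
rewrite (ssrcomplements.big_mksub [the subFinType _ of 'X_{1..n < k}])
  ?msupp_uniq //=; first last.
  by move=> m /msize_mdeg_lt /leq_trans; apply.
by rewrite big_rmcond //= => j /memN_msupp_eq0 ->; rewrite mul0r.
Qed.

Lemma moment_functional_is_linear : linear moment_functional.
Proof.
move=> c p q.
pose k := maxn (maxn (msize p) (msize q)) (msize (c *: p + q)).
rewrite !(@moment_functionalwE _ k) /k; try lia.
rewrite scaler_sumr -big_split; apply: eq_bigr => m _.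
by rewrite mcoeffD mcoeffZ /GRing.scale/=; ring.
Qed.

HB.instance Definition _ := GRing.isLinear.Build R {mpoly R[n]} R^o *:%R
  moment_functional moment_functional_is_linear.

Lemma moment_functionalX m :
  moment_functional 'X_[m] = \prod_(i < n) g (m i).
Proof. by rewrite /moment_functional msuppX big_seq1 mcoeffX eqxx mul1r. Qed.

Lemma gaussian_moment_functional a : (forall k, a * g k.+1 = k%:R * g k.-1) ->
  gaussian_functional a moment_functional.
Proof.
move=> g_rec i p; elim/mpolyind: p => [|c m p _ _ ih].
  by rewrite mulr0 mderiv0 !linear0 mulr0.
rewrite mulrDr mderivD !linearD mulrDr ih; congr (_ + _).
rewrite -scalerAr mderivZ !linearZ/= /GRing.scale/= mulrCA; congr (_ * _).
rewrite -mpolyXD mderivX linearZ/= !moment_functionalX.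
rewrite (bigD1 i)//= [in RHS](bigD1 i)//= mnmDE mnm1E eqxx mnmBE mnm1E eqxx.
have -> : \prod_(j < n | j != i) g ((U_(i) + m)%MM j) =
    \prod_(j < n | j != i) g ((m - U_(i))%MM j).
  apply: eq_bigr => j ji.
  by rewrite mnmDE mnmBE mnm1E eq_sym (negbTE ji) add0n subn0.
by rewrite mulrA g_rec subn1 -mulrA.
Qed.

End moment_functional.

Definition power_sum_vandermonde {R : comNzRingType} n k j : {mpoly R[n]} :=
  power_sum n k ^+ j * msqr_vandermonde n.

Lemma meval_power_sum_vandermonde (R : comNzRingType) n (v : 'I_n -> R) k j :
  meval v (power_sum_vandermonde n k j) =
  (\sum_(i < n) v i ^+ k) ^+ j * sqr_vandermonde v.
Proof.
rewrite rmorphM rmorphXn rmorph_sum rmorph_prod; congr (_ ^+ _ * _).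
  by apply: eq_bigr => i _; rewrite rmorphXn/= mevalXU.
apply: eq_bigr => i _; rewrite rmorph_prod; apply: eq_bigr => l _.
by rewrite rmorphXn rmorphB/= !mevalXU.
Qed.

Lemma gaussian_power_sum_moment (R : comNzRingType) k j :
  exists P : {poly R}, forall n (a : R) (g : nat -> R),
    (forall i, a * g i.+1 = i%:R * g i.-1) ->
    a ^+ uphalf (k * j) * moment_functional g (power_sum_vandermonde n k j) =
    P.[n%:R] * moment_functional g (power_sum_vandermonde n k 0).
Proof.
have [P momentE] := power_sum_prod_polynomial_moment (R := R) (nseq j k).
exists P => n a g /(gaussian_moment_functional (n := n))/momentE.
rewrite sumn_nseq /power_sum_prod big_nseq -Monoid.iteropE.
by rewrite /power_sum_vandermonde expr0 mul1r.
Qed.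

End loop_equations.

From mathcomp Require Import all_classical all_reals all_analysis.
From mathcomp Require Import measurable_realfun.

Import numFieldNormedType.Exports.

Local Open Scope classical_set_scope.
Local Open Scope ring_scope.

(** * Moments of the one-dimensional Gaussian weight *)

Section real_integrals.
Context d (T : measurableType d) (R : realType) (mu : {measure set T -> \bar R}).
Context (D : set T) (mD : measurable D).
Implicit Types f g : T -> R.

Lemma integrable_EFinZl c f : mu.-integrable D (EFin \o f) ->
  mu.-integrable D (EFin \o (fun x => c * f x)).
Proof. by move=> /(integrableZl mD c). Qed.

Lemma integrable_EFinB f g :
  mu.-integrable D (EFin \o f) -> mu.-integrable D (EFin \o g) ->
  mu.-integrable D (EFin \o (fun x => f x - g x)).
Proof. by move=> fi gi; exact: (integrableB mD fi gi). Qed.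

Context (I : Type) (s : seq I) (F : I -> T -> R).
Hypothesis Fi : forall i, mu.-integrable D (EFin \o F i).

Lemma integrable_EFin_sum :
  mu.-integrable D (EFin \o (fun x => \sum_(i <- s) F i x)).
Proof.
rewrite (_ : EFin \o _ = fun x => (\sum_(i <- s) (F i x)%:E)%E).
  by apply: integrable_sum => // i _; exact: Fi.
by apply/funext => x /=; rewrite sumEFin.
Qed.

Lemma Rintegral_sum :
  \int[mu]_(x in D) (\sum_(i <- s) F i x) = \sum_(i <- s) \int[mu]_(x in D) F i x.
Proof.
rewrite /Rintegral; under eq_integral do rewrite -sumEFin.
rewrite integral_sum//.
by rewrite sum_fine => [//|i _]; exact: (integrable_fin_num mD (Fi i)).
Qed.

End real_integrals.

Section integral_derivative.
Context {R : realType}.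
Notation mu := (@lebesgue_measure R).

Lemma Rintegral_is_derive (F f : R -> R) (a b : R) :
  (forall x : R, is_derive x 1 F (f x)) -> continuous f ->
  mu.-integrable setT (EFin \o f) ->
  F x @[x --> -oo] --> a -> F x @[x --> +oo] --> b ->
  \int[mu]_x f x = b - a.
Proof.
move=> dF cf intf Fa Fb.
have mf : measurable_fun setT f by exact: continuous_measurable_fun.
have cF : continuous F.
  by move=> x; apply: differentiable_continuous; apply/derivable1_diffP; case: (dF x).
pose f_ n := (EFin \o f) \_ `[- n%:R, n%:R].
have f_cvg : (\int[mu]_x f_ n x)%E @[n --> \oo] --> (\int[mu]_x (f x)%:E)%E.
  apply: (@dominated_cvg _ _ _ mu setT _ f_ (EFin \o f) (abse \o (EFin \o f))) => //.
  - move=> n; apply/measurable_restrict => //.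
    by rewrite setTI; apply/measurable_EFinP; exact: measurable_funS mf.
  - move=> x _; apply: cvg_near_cst; near=> n.
    rewrite /f_ patchE mem_set//= in_itv/= -ler_norml.
    by near: n; exact: nbhs_infty_ger.
  - exact: integrable_abse.
  - by move=> n x _; rewrite /f_ patchE; case: ifP => //= _; rewrite normr0 lee_fin.
have F_cvg : (\int[mu]_x f_ n x)%E @[n --> \oo] --> (b - a)%:E.
  apply: (@cvg_trans _ ((F n%:R - F (- n%:R))%:E @[n --> \oo])).
    apply: near_eq_cvg; near=> n.
    rewrite /f_ -integral_mkcond (@continuous_FTC2 _ f F)//.
    - by rewrite gtrN// ltr0n; near: n; exact: nbhs_infty_gt.
    - exact: continuous_subspaceT.
    - split; [by move=> x _; case: (dF x)|exact/cvg_at_right_filter/cF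
        |exact/cvg_at_left_filter/cF].
    - by move=> x _; rewrite derive1E; case: (dF x).
  apply: cvg_EFin; first by near=> n.
  apply: cvgB; first exact: (cvg_comp _ _ (@cvgr_idn R) Fb).
  by apply: (cvg_comp _ _ _ Fa); apply/cvgNrNy; exact: cvgr_idn.
by have := cvg_unique _ f_cvg F_cvg; rewrite /Rintegral => ->.
Unshelve. all: by end_near. Qed.

End integral_derivative.

Section gaussian_moments.
Context {R : realType}.
Notation mu := (@lebesgue_measure R).
Implicit Types (a x : R) (k : nat).

Definition gaussian_monomial a k x : R := x ^+ k * expR (- (a * (x ^+ 2 / 2))).

Lemma exprn_le_fact_expR x k : 0 <= x -> x ^+ k <= k`!%:R * expR x.
Proof.
case: k => [|k] x0; first by rewrite expr0 fact0 mul1r -expR0 ler_expR.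
have := expR_ge1Dxn k x0 => taylor.
rewrite mulrC -ler_pdivrMr ?ltr0n ?fact_gt0//.
by apply: le_trans taylor; rewrite lerDr ler01.
Qed.

Lemma gaussian_monomial_bound a k : 0 < a -> exists2 C : R, 0 <= C &
  forall x, `|gaussian_monomial a k x| <= C * expR (- (a / 4 * x ^+ 2)).
Proof.
move=> a0; exists (1 + (4 / a) ^+ k * k`!%:R).
  by rewrite addr_ge0 ?ler01// mulr_ge0 ?ler0n// exprn_ge0// divr_ge0// ltW.
move=> x; rewrite /gaussian_monomial normrM (ger0_norm (expR_ge0 _)).
set y := a / 4 * x ^+ 2.
have y0 : 0 <= y by rewrite mulr_ge0 ?sqr_ge0// divr_ge0// ltW.
have -> : expR (- (a * (x ^+ 2 / 2))) = expR (- y) * expR (- y).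
  by rewrite -expRD; congr expR; rewrite /y; field.
rewrite mulrA ler_wpM2r ?expR_ge0//.
have xk : `|x ^+ k| <= 1 + (x ^+ 2) ^+ k.
  rewrite -exprM mulnC exprM -[(x ^+ k) ^+ 2]real_normK ?num_real//.
  move: (`|x ^+ k|) (normr_ge0 (x ^+ k)) => t t0; nra.
have x2E : (x ^+ 2) ^+ k = (4 / a) ^+ k * y ^+ k.
  rewrite -exprMn; congr (_ ^+ _); rewrite /y; field; exact: lt0r_neq0.
have x2k : (x ^+ 2) ^+ k <= (4 / a) ^+ k * k`!%:R * expR y.
  rewrite x2E -mulrA ler_wpM2l ?exprn_ge0 ?divr_ge0 ?(ltW a0)//.
  exact: exprn_le_fact_expR.
rewrite expRN -ler_pdivlMr ?invr_gt0 ?expR_gt0// invrK mulrDl mul1r.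
by rewrite (le_trans xk)// lerD// -expR0 ler_expR.
Qed.

Lemma continuous_gaussian_monomial a k : continuous (gaussian_monomial a k).
Proof.
move=> x; apply: cvgM; first exact: exprn_continuous.
apply: continuous_comp; last exact: continuous_expR.
apply: cvgN; apply: cvgM; first exact: cvg_cst.
apply: cvgM; last exact: cvg_cst.
exact: exprn_continuous.
Qed.

Lemma integrable_gaussian_monomial a k : 0 < a ->
  mu.-integrable setT (EFin \o gaussian_monomial a k).
Proof.
move=> a0; have [C C0 gC] := gaussian_monomial_bound k a0.
pose s := Num.sqrt (2 / a).
have s0 : s != 0 by rewrite gt_eqF// sqrtr_gt0 divr_gt0.
have := integrable_EFinZl measurableT (C / normal_peak s) (integrable_normal_pdf 0 s).
apply: le_integrable => //.
  apply/measurable_EFinP; apply: continuous_measurable_fun.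
  exact: continuous_gaussian_monomial.
move=> x _ /=; rewrite lee_fin (le_trans (gC x))// (le_trans _ (ler_norm _))//.
rewrite normal_pdfE// /normal_fun -!mulrA ler_wpM2l//.
rewrite mulKf ?gt_eqF ?normal_peak_gt0// le_eqVlt; apply/orP; left.
apply/eqP; congr expR; rewrite /s sqr_sqrtr ?divr_ge0 ?ltW// subr0.
by field; exact: lt0r_neq0.
Qed.

Lemma gaussian_monomial_cvg0 a k (F : set_system R) {FF : Filter F} : 0 < a ->
  (forall M : R, \forall x \near F, M <= `|x|) ->
  gaussian_monomial a k x @[x --> F] --> 0.
Proof.
move=> a0 Foo; have [C C0 gC] := gaussian_monomial_bound k.+1 a0.
apply/cvgrPdist_le => e e0; near=> x.
have x0 : 0 < `|x| by rewrite (@lt_le_trans _ _ 1)//; near: x.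
rewrite sub0r normrN -(ler_pM2l x0).
have -> : `|x| * `|gaussian_monomial a k x| = `|gaussian_monomial a k.+1 x|.
  by rewrite -normrM /gaussian_monomial [x * _]mulrA -exprS.
rewrite (le_trans (gC x))// (@le_trans _ _ C)//.
  by rewrite ler_piMr// expR_le1 oppr_le0 mulr_ge0 ?sqr_ge0// divr_ge0// ltW.
by rewrite -ler_pdivrMr//; near: x.
Unshelve. all: by end_near. Qed.

Lemma is_derive_gaussian_monomial a k x : is_derive x 1 (gaussian_monomial a k)
  (k%:R * gaussian_monomial a k.-1 x - a * gaussian_monomial a k.+1 x).
Proof.
have dpow := is_derive_poly 'X^k x.
have dexp := @is_derive1_comp _ expR _ _ _ _ (is_derive_expR _)
  (is_derive_poly (- (a / 2) *: 'X^2) x).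
have := is_deriveM dpow dexp.
rewrite (_ : _ * _ = gaussian_monomial a k); last first.
  apply/funext => y; rewrite /gaussian_monomial -[LHS]/(_.[_] * expR _.[_]).
  by rewrite hornerZ !hornerXn; congr (_ * expR _); field.
move/is_derive_eq; apply.
rewrite /gaussian_monomial /GRing.scale/= derivZ !derivXn !hornerZ !hornerMn !hornerXn.
rewrite (_ : - (a / 2) * x ^+ 2 = - (a * (x ^+ 2 / 2))); last by field.
by rewrite !exprS expr0; field.
Qed.

Definition gaussian_moment a k := \int[mu]_x gaussian_monomial a k x.

Lemma gaussian_moment_rec a k : 0 < a ->
  a * gaussian_moment a k.+1 = k%:R * gaussian_moment a k.-1.
Proof.
move=> a0; have gi j := integrable_gaussian_monomial j a0.
have gc j := @continuous_gaussian_monomial a j.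
apply/eqP; rewrite eq_sym -subr_eq0 /gaussian_moment -!RintegralZl//.
rewrite -RintegralB//; [|exact: integrable_EFinZl|exact: integrable_EFinZl].
rewrite (Rintegral_is_derive (is_derive_gaussian_monomial a k) _ _ _ _
  (a := 0) (b := 0)) ?subr0//.
- by move=> x; apply: cvgB; apply: cvgM; by [exact: cvg_cst|exact: gc].
- by apply: integrable_EFinB => //; exact: integrable_EFinZl.
- apply: gaussian_monomial_cvg0 => // M; near=> x.
  rewrite -normrN (le_trans _ (ler_norm _))// lerNr; near: x.
  by apply: nbhs_ninfty_le; rewrite num_real.
- apply: gaussian_monomial_cvg0 => // M; near=> x.
  by rewrite (le_trans _ (ler_norm _))//; near: x.
Unshelve. all: by end_near. Qed.

End gaussian_moments.

(** * Integration over tuples *)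

Section tensor_integral.
Context d1 d2 (T1 : measurableType d1) (T2 : measurableType d2) (R : realType).
Context (m1 : {sigma_finite_measure set T1 -> \bar R}).
Context (m2 : {sigma_finite_measure set T2 -> \bar R}) (f : T1 -> R) (g : T2 -> R).
Hypothesis fi : m1.-integrable setT (EFin \o f).
Hypothesis gi : m2.-integrable setT (EFin \o g).

Lemma integrable_tensor :
  (m1 \x m2)%E.-integrable setT (EFin \o (fun p => f p.1 * g p.2)).
Proof.
have [[/measurable_EFinP mf foo] [/measurable_EFinP mg goo]] :=
  (integrableP _ _ _ fi, integrableP _ _ _ gi).
apply/integrable12ltyP => /=.
  apply/measurable_EFinP/measurable_funM.
    by apply: (measurableT_comp mf); exact: measurable_fst.
  by apply: (measurableT_comp mg); exact: measurable_snd.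
under eq_integral => x _.
  under eq_integral do rewrite normrM EFinM.
  rewrite ge0_integralZl//; last by apply/measurable_EFinP; exact: measurableT_comp.
  over.
rewrite ge0_integralZr//; last 2 first.
  by apply/measurable_EFinP; exact: measurableT_comp.
  exact: integral_ge0.
apply: lte_mul_pinfty => //; first exact: integral_ge0.
by rewrite ge0_fin_numE//; exact: integral_ge0.
Qed.

Lemma Rintegral_tensor :
  \int[(m1 \x m2)%E]_p (f p.1 * g p.2) = \int[m1]_x f x * \int[m2]_y g y.
Proof.
rewrite /Rintegral -integral12_prod_meas1 /fubini_F/=; last exact: integrable_tensor.
under eq_integral => x _.
  under eq_integral do rewrite EFinM.
  rewrite integralZl//.
  over.
have ffin := integrable_fin_num measurableT fi.
have gfin := integrable_fin_num measurableT gi.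
by rewrite -fineM// -(fineK gfin) integralZr.
Qed.

End tensor_integral.

Section tuple_integral.
Context {R : realType}.
Local Notation T := (measurableTypeR R).
Local Notation mu := (@lebesgue_measure R).

Lemma ge0_integral_lebesgue_tupleS n (f : n.+1.-tuple T -> \bar R) :
  measurable_fun setT f -> (forall z, 0 <= f z)%E ->
  (\int[lebesgue_tuple R n.+1]_z f z =
   \int[(mu \x lebesgue_tuple R n)%E]_p f (consp p))%E.
Proof.
move=> mf f0.
have := @ge0_integral_pushforward _ _ _ _ R (@consp _ T n) (@measurable_consp _ T n)
  (mu \x lebesgue_tuple R n)%E setT f measurableT mf (fun z _ => f0 z).
rewrite preimage_setT => <-.
by apply: eq_measure_integral => [|A mA sA]; first exact: measurable_consp.
Qed.

Section cons_integral.
Context (n : nat) (f : n.+1.-tuple T -> R).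
Hypothesis mf : measurable_fun setT f.
Hypothesis fi :
  (mu \x lebesgue_tuple R n)%E.-integrable setT (EFin \o (fun p => f (consp p))).

Lemma integrable_lebesgue_tupleS :
  (lebesgue_tuple R n.+1).-integrable setT (EFin \o f).
Proof.
apply/integrableP; split; first exact/measurable_EFinP.
rewrite ge0_integral_lebesgue_tupleS//; first by have /integrableP[] := fi.
by apply: measurableT_comp => //; exact/measurable_EFinP.
Qed.

Lemma Rintegral_lebesgue_tupleS : \int[lebesgue_tuple R n.+1]_z f z =
  \int[(mu \x lebesgue_tuple R n)%E]_p f (consp p).
Proof.
congr fine.
have := @integral_pushforward _ _ _ _ R (@consp _ T n) (@measurable_consp _ T n)
  (mu \x lebesgue_tuple R n)%E setT (EFin \o f).
by rewrite preimage_setT => <-//; exact/measurable_EFinP.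
Qed.

End cons_integral.

Lemma measurable_tuple_prod n (g : 'I_n -> R -> R) :
  (forall i, measurable_fun setT (g i)) ->
  measurable_fun setT (fun z : n.-tuple T => \prod_(i < n) g i (tnth z i)).
Proof.
move=> mg; apply: measurable_prod => i _.
by apply: (measurableT_comp (mg i)); exact: measurable_tnth.
Qed.

Lemma tuple_prod_cons n (g : 'I_n.+1 -> R -> R) (p : T * n.-tuple T) :
  \prod_(i < n.+1) g i (tnth (consp p) i) =
  g ord0 p.1 * \prod_(i < n) g (lift ord0 i) (tnth p.2 i).
Proof.
rewrite big_ord_recl; congr (_ * _).
by apply: eq_bigr => i _; congr (g _ _); rewrite tnthS.
Qed.

Lemma integrable_tuple_prod_consp n (g : 'I_n.+1 -> R -> R) :
  mu.-integrable setT (EFin \o g ord0) ->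
  (lebesgue_tuple R n).-integrable setT
    (EFin \o (fun z => \prod_(i < n) g (lift ord0 i) (tnth z i))) ->
  (mu \x lebesgue_tuple R n)%E.-integrable setT
    (EFin \o (fun p => \prod_(i < n.+1) g i (tnth (consp p) i))).
Proof.
move=> head_int tail_int; have := integrable_tensor head_int tail_int.
by apply: eq_integrable => // p _; rewrite /= tuple_prod_cons.
Qed.

Lemma integrable_tuple_prod n (g : 'I_n -> R -> R) :
  (forall i, mu.-integrable setT (EFin \o g i)) ->
  (lebesgue_tuple R n).-integrable setT
    (EFin \o (fun z => \prod_(i < n) g i (tnth z i))).
Proof.
elim: n g => [|n ih] g ig; last apply: integrable_lebesgue_tupleS.
- rewrite (_ : EFin \o _ = cst 1%E).
    apply/integrableP; split; first exact: measurable_cst.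
    by under eq_integral do rewrite abse1; rewrite /= integral_dirac// diracT mul1e ltry.
  by apply/funext => z /=; rewrite big_ord0.
- by apply: measurable_tuple_prod => i; have /integrableP[/measurable_EFinP] := ig i.
- exact: integrable_tuple_prod_consp (ig ord0) (ih _ (fun i => ig (lift ord0 i))).
Qed.

Lemma Rintegral_tuple_prod n (g : 'I_n -> R -> R) :
  (forall i, mu.-integrable setT (EFin \o g i)) ->
  \int[lebesgue_tuple R n]_z (\prod_(i < n) g i (tnth z i)) =
  \prod_(i < n) \int[mu]_x g i x.
Proof.
elim: n g => [|n ih] g ig.
  rewrite big_ord0 /Rintegral; under eq_integral do rewrite big_ord0.
  by rewrite /= integral_dirac// diracT mul1e.
have tail_int := integrable_tuple_prod (fun i => ig (lift ord0 i)).
rewrite Rintegral_lebesgue_tupleS.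
- under eq_Rintegral do rewrite tuple_prod_cons.
  rewrite (Rintegral_tensor (ig ord0) tail_int) big_ord_recl.
  by congr (_ * _); apply: ih => i.
- by apply: measurable_tuple_prod => i; have /integrableP[/measurable_EFinP] := ig i.
- exact: integrable_tuple_prod_consp (ig ord0) tail_int.
Qed.

End tuple_integral.

(** * Expectations under the Gaussian ensemble *)

Section gaussian_ensemble.
Context {R : realType}.
Local Notation T := (measurableTypeR R).
Local Notation mu := (@lebesgue_measure R).
Implicit Types (n k : nat) (a : R).

Definition gaussian_weight n a (z : n.-tuple T) : R :=
  \prod_(j < n) expR (- (a * (tnth z j ^+ 2 / 2))).

Definition gaussian_density n a (z : n.-tuple T) : R :=
  sqr_vandermonde (tnth z) * gaussian_weight a z.

Lemma gaussian_density_ge0 n a (z : n.-tuple T) : 0 <= gaussian_density a z.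
Proof.
rewrite mulr_ge0//; last by apply: prodr_ge0 => j _; exact: expR_ge0.
by apply: prodr_ge0 => j _; apply: prodr_ge0 => k _; exact: sqr_ge0.
Qed.

Section polynomial_integral.
Context (n : nat) (a : R) (p : mpoly.mpoly n R).
Hypothesis a_gt0 : 0 < a.

Let factor (m : mpoly.multinom n) (i : 'I_n) :=
  gaussian_monomial a (mpoly.fun_of_multinom m i).
Let monomial m (z : n.-tuple T) := \prod_(i < n) factor m i (tnth z i).

Let mevalE (z : n.-tuple T) : mpoly.meval (tnth z) p * gaussian_weight a z =
  \sum_(m <- mpoly.msupp p) mpoly.mcoeff m p * monomial m z.
Proof.
rewrite mpoly.mevalE mulr_suml; apply: eq_bigr => m _.
by rewrite -mulrA -big_split.
Qed.

Let factor_integrable m i : mu.-integrable setT (EFin \o factor m i).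
Proof. exact: integrable_gaussian_monomial. Qed.

Let monomial_integrable m :
  (lebesgue_tuple R n).-integrable setT (EFin \o monomial m).
Proof. exact: integrable_tuple_prod (factor_integrable m). Qed.

Lemma integrable_meval_gaussian : (lebesgue_tuple R n).-integrable setT
  (EFin \o (fun z => mpoly.meval (tnth z) p * gaussian_weight a z)).
Proof.
rewrite (_ : (fun z => _) = fun z =>
  \sum_(m <- mpoly.msupp p) mpoly.mcoeff m p * monomial m z); last exact/funext.
by apply: integrable_EFin_sum => // m; exact: integrable_EFinZl.
Qed.

Lemma Rintegral_meval_gaussian :
  \int[lebesgue_tuple R n]_z (mpoly.meval (tnth z) p * gaussian_weight a z) =
  moment_functional (gaussian_moment a) p.
Proof.
under eq_Rintegral do rewrite mevalE.
rewrite Rintegral_sum => [|//|m]; last exact: integrable_EFinZl.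
apply: eq_bigr => m _; rewrite RintegralZl//; congr (_ * _).
exact: Rintegral_tuple_prod (factor_integrable m).
Qed.

End polynomial_integral.

(* Points of two distinct intervals [2i, 2i + 1] are at distance at least 1, so
   that the Vandermonde factor is at least 1 on the product of these intervals. *)
Definition interval_minorant a i (x : R) : R :=
  expR (- (a * ((i.*2.+1)%:R ^+ 2 / 2))) * \1_(`[(i.*2)%:R, (i.*2.+1)%:R] : set R) x.

Lemma gaussian_density_lower_bound n a (z : n.-tuple T) : 0 < a ->
  \prod_(i < n) interval_minorant a i (tnth z i) <= gaussian_density a z.
Proof.
move=> a0; rewrite /interval_minorant.
have [/forallP zin|] := boolP [forall i : 'I_n,
    (i.*2)%:R <= tnth z i <= (i.*2.+1)%:R]; last first.
  rewrite negb_forall => /existsP[i zi].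
  rewrite (bigD1 i)//= indicE memNset ?mulr0 ?mul0r ?gaussian_density_ge0//.
  by rewrite /= in_itv/=; exact/negP.
have V_ge1 : 1 <= sqr_vandermonde (tnth z).
  apply: (big_ind (fun x => 1 <= x)) => // [x y|j _]; first exact: mulr_ege1.
  apply: (big_ind (fun x => 1 <= x)) => // [x y|k jk]; first exact: mulr_ege1.
  have /andP[_ zj] := zin j; have /andP[zk _] := zin k.
  have : (j.*2.+2 <= k.*2)%N by rewrite -doubleS leq_double.
  rewrite -(ler_nat R) -natr1 => jk2.
  have : 1 <= tnth z k - tnth z j by lra.
  by move: (tnth z j) (tnth z k) => x y; nra.
rewrite -[leLHS]mul1r; apply: ler_pM => //.
  by apply: prodr_ge0 => i _; rewrite mulr_ge0 ?expR_ge0.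
apply: ler_prod => i _; rewrite indicE mem_set ?mulr1; last by rewrite /= in_itv/= zin.
rewrite expR_ge0 ler_expR lerN2 (ler_wpM2l (ltW a0))// ler_wpM2r ?invr_ge0//.
have /andP[z1 z2] := zin i.
by rewrite lerXn2r ?nnegrE// (le_trans _ z1).
Qed.

Section power_sum_integral.
Context (n k : nat) (a : R).
Hypothesis a_gt0 : 0 < a.

Let mevalE j z : (\sum_(i < n) tnth z i ^+ k) ^+ j * gaussian_density a z =
  mpoly.meval (tnth z) (power_sum_vandermonde n k j) * gaussian_weight a z.
Proof. by rewrite meval_power_sum_vandermonde mulrA. Qed.

Lemma integrable_power_sum_density j : (lebesgue_tuple R n).-integrable setT
  (EFin \o (fun z => (\sum_(i < n) tnth z i ^+ k) ^+ j * gaussian_density a z)).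
Proof. by rewrite (funext (mevalE j)); exact: integrable_meval_gaussian. Qed.

Lemma Rintegral_power_sum_density j :
  \int[lebesgue_tuple R n]_z
    ((\sum_(i < n) tnth z i ^+ k) ^+ j * gaussian_density a z) =
  moment_functional (gaussian_moment a) (power_sum_vandermonde n k j).
Proof. by rewrite (funext (mevalE j)) Rintegral_meval_gaussian. Qed.

End power_sum_integral.

Lemma integrable_gaussian_density n a : 0 < a ->
  (lebesgue_tuple R n).-integrable setT (EFin \o @gaussian_density n a).
Proof.
move=> a0; have := integrable_power_sum_density n 0 a0 0.
by apply: eq_integrable => // z _ /=; rewrite mul1r.
Qed.

Lemma Rintegral_gaussian_density_gt0 n a : 0 < a ->
  0 < \int[lebesgue_tuple R n]_z gaussian_density a z.
Proof.
move=> a0; have ig (i : 'I_n) : mu.-integrable setT (EFin \o interval_minorant a i).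
  by apply: integrable_EFinZl => //; exact: integrable_indic_itv.
apply: lt_le_trans (le_Rintegral measurableT (integrable_tuple_prod ig)
  (integrable_gaussian_density n a0) (fun z _ => gaussian_density_lower_bound z a0)).
rewrite (Rintegral_tuple_prod ig); apply: prodr_gt0 => i _.
rewrite /interval_minorant RintegralZl//; last exact: integrable_indic_itv.
rewrite mulr_gt0 ?expR_gt0// /Rintegral integral_indic//=.
rewrite setIT lebesgue_measure_itv/= lte_fin ltr_nat ltnSn -EFinB/=.
by rewrite subr_gt0 ltr_nat.
Qed.

Lemma power_sum_density_polynomial k j :
  exists P : {poly R}, forall n a, 0 < a ->
    a ^+ uphalf (k * j) * \int[lebesgue_tuple R n]_z
      ((\sum_(i < n) tnth z i ^+ k) ^+ j * gaussian_density a z) =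
    P.[n%:R] * \int[lebesgue_tuple R n]_z gaussian_density a z.
Proof.
have [P momentE] := gaussian_power_sum_moment R k j; exists P => n a a0.
rewrite Rintegral_power_sum_density// momentE => [|i]; last exact: gaussian_moment_rec.
rewrite -Rintegral_power_sum_density//; congr (_ * _).
by apply: eq_Rintegral => z _; rewrite mul1r.
Qed.

End gaussian_ensemble.

(** * Taylor estimates for the exponential and the logarithm *)

Section taylor_estimates.
Context {R : realType}.
Implicit Types (a b x y w C : R) (k : nat).

Lemma dist_le_derive (f df : R -> R) a b C :
  (forall x, Num.min a b <= x <= Num.max a b -> is_derive x 1 f (df x)) ->
  (forall x, Num.min a b <= x <= Num.max a b -> `|df x| <= C) ->
  `|f b - f a| <= C * `|b - a|.
Proof.
wlog ab : a b / a <= b => [wlog_ab|].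
  have /orP[ab|ba] := le_total a b; first exact: wlog_ab.
  by rewrite distrC (distrC b) minC maxC; exact: wlog_ab.
rewrite (min_idPl ab) (max_idPr ab) => fdf dfC.
have [x||x xab ->] := @MVT_segment R f df a b ab.
- by rewrite in_itv/= => /andP[/ltW ax /ltW xb]; apply: fdf; rewrite ax.
- apply: continuous_in_subspaceT => x; rewrite inE/= in_itv/= => /fdf[dx _].
  exact/differentiable_continuous/derivable1_diffP.
by rewrite normrM ler_wpM2r// dfC//; move: xab; rewrite in_itv.
Qed.

Definition expN_taylor k : {poly R} := \poly_(j < k) ((-1) ^+ j / j`!%:R).

Lemma deriv_expN_taylor k : (expN_taylor k.+1)^`() = - expN_taylor k.
Proof.
apply/polyP => i; rewrite coef_deriv coefN !coef_poly ltnS.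
case: ifP => _; last by rewrite oppr0 mul0rn.
rewrite factS natrM -mulr_natr exprS invfM.
have ? : i.+1%:R != 0 :> R by rewrite pnatr_eq0.
have ? : i`!%:R != 0 :> R by rewrite pnatr_eq0 -lt0n fact_gt0.
by field; apply/andP.
Qed.

Lemma expRN_taylor_bound k y : 0 <= y ->
  `|expR (- y) - (expN_taylor k).[y]| <= y ^+ k.
Proof.
elim: k y => [|k ih] y y0.
  rewrite /expN_taylor horner_poly big_ord0 subr0 expr0 ger0_norm ?expR_ge0//.
  by rewrite expR_le1 oppr_le0.
pose f x := expR (- x) - (expN_taylor k.+1).[x].
have f0 : f 0 = 0.
  by rewrite /f horner_coef0 coef_poly oppr0 expR0 fact0 expr0 divr1 subrr.
suff: `|f y - f 0| <= y ^+ k * `|y - 0| by rewrite f0 !subr0 (ger0_norm y0) -exprSr.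
apply: (@dist_le_derive f (fun x => - (expR (- x) - (expN_taylor k).[x]))).
  move=> x _; have dexp := @is_derive1_comp _ expR _ _ _ _ (is_derive_expR _)
    (is_deriveNid x 1).
  have := is_deriveB dexp (is_derive_poly (expN_taylor k.+1) x).
  by move/is_derive_eq; apply; rewrite deriv_expN_taylor hornerN; ring.
move=> x; rewrite (min_idPl y0) (max_idPr y0) => /andP[x0 xy].
by rewrite normrN (le_trans (ih x x0))// lerXn2r ?nnegrE.
Qed.

Definition ln1p_taylor k : {poly R} :=
  \sum_(i < k) ((-1) ^+ i / i.+1%:R) *: 'X^(i.+1).

Lemma deriv_ln1p_taylor k : (ln1p_taylor k)^`() * (1 + 'X) = 1 - (- 'X) ^+ k.
Proof.
rewrite /ln1p_taylor raddf_sum/= (eq_bigr (fun i : 'I_k => (- 'X) ^+ i)).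
  by rewrite -[1 - _]opprB subrX1; ring.
move=> i _; rewrite derivZ derivXn -['X^_ *+ _]scaler_nat scalerA divfK ?pnatr_eq0//.
by rewrite [RHS]exprNn -polyC1 -polyCN -polyC_exp mul_polyC.
Qed.

Lemma is_derive_ln1p_remainder k x : 0 < 1 + x ->
  is_derive x 1 (fun y : R => ln (1 + y) - (ln1p_taylor k).[y])
    ((- x) ^+ k / (1 + x)).
Proof.
move=> x0; have x_neq0 : 1 + x != 0 by rewrite gt_eqF.
have d1p : is_derive x 1 (fun y : R => 1 + y) 1.
  have := is_deriveD (is_derive_cst (1 : R) x 1) (is_derive_id x (1 : R)).
  by rewrite add0r.
have dln := @is_derive1_comp _ (@ln R) (fun y => 1 + y) x _ 1 (is_derive1_ln x0) d1p.
have := is_deriveB dln (is_derive_poly (ln1p_taylor k) x).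
move/is_derive_eq; apply; apply: (mulIf x_neq0).
have := congr1 (horner^~ x) (deriv_ln1p_taylor k).
by rewrite !hornerE => deriv_x; rewrite mulrBl deriv_x; field.
Qed.

Lemma ln1p_taylor_bound k w : `|w| <= 2^-1 ->
  `|ln (1 + w) - (ln1p_taylor k).[w]| <= 2 * `|w| ^+ k.+1.
Proof.
move=> w2; pose f x := ln (1 + x) - (ln1p_taylor k).[x].
have f0 : f 0 = 0.
  rewrite /f addr0 ln1 /ln1p_taylor horner_sum big1 ?subrr// => i _.
  by rewrite hornerZ hornerXn expr0n mulr0.
have near0 x : Num.min 0 w <= x <= Num.max 0 w -> `|x| <= `|w|.
  rewrite ge_min le_max => /andP[lex gex].
  by rewrite ler_norml; case: (ger0P w) lex gex; lra.
have gt0_1p x : `|x| <= `|w| -> 2^-1 <= 1 + x.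
  by move=> /le_trans/(_ w2); rewrite ler_norml; lra.
suff: `|f w - f 0| <= 2 * `|w| ^+ k * `|w - 0| by rewrite f0 !subr0 exprSr mulrA.
apply: (dist_le_derive (df := fun x => (- x) ^+ k / (1 + x))) => x /near0 xw.
  by apply: is_derive_ln1p_remainder; have := gt0_1p x xw; lra.
have x1 := gt0_1p x xw; have x0 : 0 < 1 + x by lra.
rewrite normrM normrX normrN normfV (gtr0_norm x0) mulrC.
apply: ler_pM; rewrite ?exprn_ge0 ?invr_ge0 ?(ltW x0)//.
  by rewrite invf_ple ?posrE.
by rewrite lerXn2r ?nnegrE.
Qed.

End taylor_estimates.

Section laplace_taylor.
Context d (T : measurableType d) (R : realType) (mu : {measure set T -> \bar R}).
Context (w y : T -> R).
Hypotheses (w_ge0 : forall z, 0 <= w z) (y_ge0 : forall z, 0 <= y z).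
Hypothesis measurable_y : measurable_fun setT y.
Hypothesis integrable_moment :
  forall j, mu.-integrable setT (EFin \o (fun z => y z ^+ j * w z)).

Let integrable_w : mu.-integrable setT (EFin \o w).
Proof.
by apply: eq_integrable (integrable_moment 0) => // z _; rewrite /= mul1r.
Qed.

Let integrable_laplace :
  mu.-integrable setT (EFin \o (fun z => expR (- y z) * w z)).
Proof.
apply: (le_integrable _ _ _ integrable_w) => //.
  apply/measurable_EFinP; apply: measurable_funM.
    apply: (measurableT_comp (@measurable_expR R)).
    exact: (measurableT_comp (@oppr_measurable R _)).
  by have /integrableP[/measurable_EFinP] := integrable_w.
move=> z _ /=; rewrite lee_fin normrM ler_piMl//.
by rewrite ger0_norm ?expR_ge0// expR_le1 oppr_le0.
Qed.

Lemma Rintegral_expRN_taylor_bound k :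
  `|\int[mu]_z (expR (- y z) * w z) -
    \sum_(j < k) (-1) ^+ j / j`!%:R * \int[mu]_z (y z ^+ j * w z)| <=
  \int[mu]_z (y z ^+ k * w z).
Proof.
have integrable_term (j : 'I_k) := integrable_EFinZl measurableT ((-1) ^+ j / j`!%:R)
  (integrable_moment j).
under eq_bigr do rewrite -RintegralZl//.
rewrite -Rintegral_sum// -RintegralB//; last exact: integrable_EFin_sum.
have integrable_taylor :=
  integrable_EFin_sum measurableT (index_enum 'I_k) integrable_term.
have integrable_diff := integrable_EFinB measurableT integrable_laplace integrable_taylor.
apply: (le_trans (le_normr_Rintegral _ integrable_diff)) => //.
apply: le_Rintegral => //; first exact: integrable_norm.
move=> z _; under eq_bigr do rewrite mulrA.
rewrite -mulr_suml -mulrBl normrM (ger0_norm (w_ge0 z)) ler_wpM2r//.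
by have := expRN_taylor_bound k (y_ge0 z); rewrite /expN_taylor horner_poly.
Qed.

End laplace_taylor.

(** * Expansion of the partition function and of the free energy *)

Section partition_function.
Context {R : realType} (nu : nat).
Hypothesis nu_gt0 : (0 < nu)%N.
Local Notation T := (measurableTypeR R).
Implicit Types (n N j k : nat) (u t : R).

Definition perturbation n (z : n.-tuple T) : R :=
  (\sum_(i < n) tnth z i ^+ (2 * nu)) / (2 * nu)%:R.

Lemma perturbation_ge0 n (z : n.-tuple T) : 0 <= perturbation z.
Proof.
rewrite divr_ge0// sumr_ge0// => i _; rewrite exprM exprn_ge0//.
exact: sqr_ge0.
Qed.

Lemma measurable_perturbation n : measurable_fun setT (@perturbation n).
Proof.
apply: measurable_funM; last exact: measurable_cst.
apply: measurable_sum => i; apply: measurable_funX; exact: measurable_tnth.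
Qed.

Lemma partition_functionE n N u : partition_function nu n N u =
  \int[lebesgue_tuple R n]_z
    (expR (- (N%:R * u * perturbation z)) * gaussian_density N%:R z).
Proof.
apply: eq_Rintegral => z _; rewrite [RHS]mulrCA; congr (_ * _).
rewrite /perturbation mulr_suml mulr_sumr -sumrN expR_sum -big_split/=.
apply: eq_bigr => j _; rewrite -expRD; congr expR.
by rewrite /potential; ring.
Qed.

Lemma partition_function0E n N : partition_function nu n N (0 : R) =
  \int[lebesgue_tuple R n]_z gaussian_density N%:R z.
Proof.
rewrite partition_functionE; apply: eq_Rintegral => z _.
by rewrite mulr0 mul0r oppr0 expR0 mul1r.
Qed.

Lemma partition_function0_gt0 n N : (0 < N)%N -> 0 < partition_function nu n N (0 : R).
Proof.
by move=> N0; rewrite partition_function0E Rintegral_gaussian_density_gt0 ?ltr0n.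
Qed.

Lemma perturbation_densityE j n N (z : n.-tuple T) :
  perturbation z ^+ j * gaussian_density N%:R z = (2 * nu)%:R ^- j *
  ((\sum_(i < n) tnth z i ^+ (2 * nu)) ^+ j * gaussian_density N%:R z).
Proof. by rewrite /perturbation exprMn exprVn; ring. Qed.

Lemma integrable_perturbation_density j n N : (0 < N)%N ->
  (lebesgue_tuple R n).-integrable setT
    (EFin \o (fun z => perturbation z ^+ j * gaussian_density N%:R z)).
Proof.
move=> N0; rewrite (funext (@perturbation_densityE j n N)).
apply: integrable_EFinZl => //; apply: integrable_power_sum_density.
by rewrite ltr0n.
Qed.

Lemma perturbation_moment_polynomial : exists m : nat -> {poly R}, m 0 = 1 /\
  forall j n N, (0 < N)%N ->
    N%:R ^+ (nu * j) *
      \int[lebesgue_tuple R n]_z (perturbation z ^+ j * gaussian_density N%:R z) =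
    (m j).[n%:R] * partition_function nu n N 0.
Proof.
have [P momentE] := choice (@power_sum_density_polynomial R (2 * nu)).
exists (fun j => if j is 0%N then 1 else (2 * nu)%:R ^- j *: P j).
split=> // -[|j] n N N0.
  rewrite muln0 expr0 hornerC !mul1r partition_function0E.
  by apply: eq_Rintegral => z _; rewrite mul1r.
have N_gt0 : 0 < N%:R :> R by rewrite ltr0n.
rewrite partition_function0E hornerZ -mulrA -momentE//.
rewrite (funext (@perturbation_densityE j.+1 n N)) RintegralZl//; last first.
  exact: integrable_power_sum_density.
by rewrite mulrCA; congr (_ * (_ ^+ _ * _)); lia.
Qed.

Lemma partition_function_expansion : exists p : nat -> {poly R}, p 0 = 1 /\
  forall k, exists q : {poly R}, forall n N u t, (0 < N)%N -> 0 <= u ->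
    t = u / N%:R ^+ nu.-1 ->
    `|partition_function nu n N u / partition_function nu n N 0 -
      \sum_(j < k) (p j).[n%:R] * t ^+ j| <= q.[n%:R] * t ^+ k.
Proof.
have [m [m0 perturbation_momentE]] := perturbation_moment_polynomial.
exists (fun j => ((-1) ^+ j / j`!%:R) *: m j); split.
  by rewrite m0 fact0 divr1 scale1r.
move=> k; exists (m k) => n N u t N0 u0 tE.
have N_gt0 : 0 < N%:R :> R by rewrite ltr0n.
pose y (z : n.-tuple T) := N%:R * u * perturbation z.
have yE j z : y z ^+ j * gaussian_density N%:R z =
    (N%:R * u) ^+ j * (perturbation z ^+ j * gaussian_density N%:R z).
  by rewrite /y exprMn mulrA.
have momentE j : \int[lebesgue_tuple R n]_z (y z ^+ j * gaussian_density N%:R z) =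
    t ^+ j * ((m j).[n%:R] * partition_function nu n N 0).
  rewrite -perturbation_momentE// mulrA (funext (yE j)) RintegralZl//; last first.
    exact: integrable_perturbation_density.
  congr (_ * _); rewrite exprM -exprMn tE; congr (_ ^+ _).
  by rewrite -[X in _ * _ ^+ X](prednK nu_gt0) exprS mulrCA divfK// expf_neq0// gt_eqF.
have Z0 := partition_function0_gt0 n N0.
rewrite -(ler_pM2r Z0) -[X in _ * X <= _](gtr0_norm Z0) -normrM mulrBl.
rewrite divfK ?gt_eqF// mulr_suml -mulrA mulrCA -momentE partition_functionE.
have -> : \sum_(j < k) (((-1) ^+ j / j`!%:R) *: m j).[n%:R] * t ^+ j *
    partition_function nu n N 0 = \sum_(j < k) (-1) ^+ j / j`!%:R *
    \int[lebesgue_tuple R n]_z (y z ^+ j * gaussian_density N%:R z).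
  by apply: eq_bigr => j _; rewrite momentE hornerZ; ring.
apply: Rintegral_expRN_taylor_bound => [z|z||j].
- exact: gaussian_density_ge0.
- by rewrite mulr_ge0 ?perturbation_ge0// mulr_ge0// ltW.
- by apply: measurable_funM; [exact: measurable_cst|exact: measurable_perturbation].
- rewrite (funext (yE j)); apply: integrable_EFinZl => //.
  exact: integrable_perturbation_density.
Qed.

End partition_function.

Section polynomial_bigO.
Context {R : realType} {I : Type} (D : set I) (n : I -> nat) (t : I -> R).
Hypothesis t_ge0 : forall i, D i -> 0 <= t i.
Implicit Types (e X w v : I -> R) (K : nat).

(* [n.+2] is at least 2, so that its powers also absorb constants. *)
Local Notation base i := ((n i).+2%:R : R).

Definition polyO_bound B K e := forall i, D i -> base i ^+ B * t i <= 1 ->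
  `|e i| <= base i ^+ B * t i ^+ K.

Definition polyO K e := exists B, polyO_bound B K e.

Let base_ge1 i : 1 <= base i.
Proof. by rewrite ler1n. Qed.

Let baseX_ge1 i B : 1 <= base i ^+ B.
Proof. by rewrite exprn_ege1. Qed.

Let baseX_le i B B' : (B <= B')%N -> base i ^+ B <= base i ^+ B'.
Proof. by move=> BB'; rewrite ler_weXn2l. Qed.

Let regime_le B B' i : (B <= B')%N -> D i ->
  base i ^+ B' * t i <= 1 -> base i ^+ B * t i <= 1.
Proof.
by move=> BB' Di; apply: le_trans; rewrite ler_wpM2r ?t_ge0 ?baseX_le.
Qed.

Let t_le1 B i : D i -> base i ^+ B * t i <= 1 -> t i <= 1.
Proof. by move=> Di; apply: le_trans; rewrite ler_peMl ?t_ge0. Qed.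

Lemma polyO_bound_le B B' K e : (B <= B')%N -> polyO_bound B K e -> polyO_bound B' K e.
Proof.
move=> BB' eB i Di reg; rewrite (le_trans (eB i Di (regime_le BB' Di reg)))//.
by rewrite ler_wpM2r ?exprn_ge0 ?t_ge0 ?baseX_le.
Qed.

Lemma eq_polyO K e e' : (forall i, D i -> e i = e' i) -> polyO K e -> polyO K e'.
Proof. by move=> ee' [B eB]; exists B => i Di; rewrite -ee'//; exact: eB. Qed.

Lemma polyO_leq K K' e : (K' <= K)%N -> polyO K e -> polyO K' e.
Proof.
move=> KK' [B eB]; exists B => i Di reg; rewrite (le_trans (eB i Di reg))//.
by rewrite ler_wpM2l// ler_wiXn2l ?t_ge0 ?(t_le1 Di reg).
Qed.

Lemma polyO0 K : polyO K (fun=> 0).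
Proof.
by exists 0%N => i Di _; rewrite normr0 mul1r exprn_ge0 ?t_ge0.
Qed.

Lemma polyO_cst c : polyO 0 (fun=> c).
Proof.
exists (Num.truncn `|c|).+1 => i Di _; rewrite mulr1.
rewrite (le_trans (ltW (truncnS_gt _)))// (@le_trans _ _ (2 ^+ (Num.truncn `|c|).+1))//.
  by rewrite -natrX ler_nat ltnW// ltn_expl.
by rewrite lerXn2r ?nnegrE// ler_nat.
Qed.

Lemma polyOD K e e' : polyO K e -> polyO K e' -> polyO K (fun i => e i + e' i).
Proof.
move=> [B eB] [B' eB']; exists (B + B').+1 => i Di reg.
have BB' : (B + B' <= (B + B').+1)%N by [].
have ei1 := polyO_bound_le (leq_addr B' B) eB Di (regime_le BB' Di reg).
have ei2 := polyO_bound_le (leq_addl B B') eB' Di (regime_le BB' Di reg).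
rewrite (le_trans (ler_normD _ _))// (le_trans (lerD ei1 ei2))//.
rewrite -mulr2n -[leLHS]mulr_natl exprS -[leRHS]mulrA ler_wpM2r ?ler_nat//.
by rewrite mulr_ge0 ?exprn_ge0 ?t_ge0.
Qed.

Lemma polyOM K K' e e' : polyO K e -> polyO K' e' -> polyO (K + K') (fun i => e i * e' i).
Proof.
move=> [B eB] [B' eB']; exists (B + B')%N => i Di reg.
rewrite normrM !exprD mulrACA ler_pM//.
  by apply: eB => //; apply: regime_le reg => //; exact: leq_addr.
by apply: eB' => //; apply: regime_le reg => //; exact: leq_addl.
Qed.

Lemma polyO_t : polyO 1 t.
Proof. by exists 0%N => i Di _; rewrite mul1r expr1 ger0_norm ?t_ge0. Qed.

Lemma polyOX K m e : polyO K e -> polyO (K * m) (fun i => e i ^+ m).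
Proof.
move=> eK; elim: m => [|m ih]; first by rewrite muln0; exact: polyO_cst.
by rewrite mulnS; apply: eq_polyO (polyOM eK ih) => i _; rewrite exprS.
Qed.

Lemma polyO_horner (p : {poly R}) e : polyO 0 e -> polyO 0 (fun i => p.[e i]).
Proof.
move=> e0; elim/poly_ind: p => [|p c ih].
  by apply: eq_polyO (polyO0 0) => i _; rewrite horner0.
apply: eq_polyO (polyOD (polyOM ih e0) (polyO_cst c)) => i _.
by rewrite hornerMXaddC.
Qed.

Lemma polyO_hornerB (p : {poly R}) K w v : polyO 0 w -> polyO 0 v ->
  polyO K (fun i => w i - v i) -> polyO K (fun i => p.[w i] - p.[v i]).
Proof.
move=> w0 v0 wv; elim/poly_ind: p => [|p c ih].
  by apply: eq_polyO (polyO0 K) => i _; rewrite !horner0 subrr.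
have := polyOD (polyOM ih w0) (polyOM wv (polyO_horner p v0)).
by rewrite addn0; apply: eq_polyO => i _; rewrite !hornerMXaddC; ring.
Qed.

Definition eval_nt (p : {poly {poly R}}) i := p.[(t i)%:P].[(n i)%:R].

Lemma polyO_eval_nt p : polyO 0 (eval_nt p).
Proof.
elim/poly_ind: p => [|p c ih].
  by apply: eq_polyO (polyO0 0) => i _; rewrite /eval_nt !horner0.
have n0 : polyO 0 (fun i => (n i)%:R).
  exists 1 => i Di _; rewrite normr_nat mulr1 ler_nat; exact: leqW (leqnSn _).
have := polyOD (polyOM ih (polyO_leq (leq0n _) polyO_t)) (polyO_horner c n0).
by apply: eq_polyO => i _; rewrite /eval_nt hornerMXaddC hornerD hornerM hornerC.
Qed.

Lemma polyO_eval_ntMXn p K : polyO K (eval_nt (p * 'X^K)).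
Proof.
have := polyOM (polyO_eval_nt p) (polyOX K polyO_t); rewrite mul1n.
by apply: eq_polyO => i _; rewrite /eval_nt hornerM hornerXn hornerM horner_exp hornerC.
Qed.

Lemma polyO_ln1p K w : polyO 1 w ->
  polyO K.+1 (fun i => ln (1 + w i) - (ln1p_taylor K).[w i]).
Proof.
move=> [B wB]; exists (B * K.+1).+1 => i Di reg.
have BK : (B <= B * K.+1)%N by rewrite leq_pmulr.
have wi := wB i Di (regime_le (leqW BK) Di reg).
have w2 : `|w i| <= 2^-1.
  rewrite (le_trans wi)// expr1 -div1r ler_pdivlMr// (le_trans _ reg)//.
  rewrite mulrAC ler_wpM2r ?t_ge0// exprSr ler_pM ?baseX_le//.
  by rewrite ler_nat.
rewrite (le_trans (ln1p_taylor_bound K w2))// [X in _ <= X * _]exprS -mulrA ler_pM//.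
  by rewrite ler_nat.
by rewrite exprM -exprMn lerXn2r ?nnegrE// ?mulr_ge0 ?t_ge0// -[t i]expr1.
Qed.

Lemma polyO_ln K X (p : {poly {poly R}}) : p`_0 = 1 ->
  polyO K.+1 (fun i => X i - eval_nt p i) ->
  exists r : {poly {poly R}}, polyO K.+1 (fun i => ln (X i) - eval_nt r i).
Proof.
move=> p0 Xp; pose v := eval_nt (drop_poly 1 p * 'X^1).
have pv i : eval_nt p i = 1 + v i.
  rewrite -{1}(poly_take_drop 1 p) /eval_nt hornerD.
  rewrite (_ : take_poly 1 p = 1) ?hornerD ?hornerC//.
  by apply/polyP => -[|j]; rewrite coef_take_poly coef1.
have wv : polyO K.+1 (fun i => (X i - 1) - v i).
  by apply: eq_polyO Xp => i _; rewrite pv opprD addrA.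
have v1 : polyO 1 v := polyO_eval_ntMXn _ 1.
have w1 : polyO 1 (fun i => X i - 1).
  have := polyOD (polyO_leq (ltn0Sn K) wv) v1.
  by apply: eq_polyO => i _; rewrite subrK.
exists (map_poly polyC (ln1p_taylor K) \Po (drop_poly 1 p * 'X^1)).
have := polyOD (polyO_ln1p K w1) (polyO_hornerB (ln1p_taylor K)
  (polyO_leq (leq0n 1) w1) (polyO_leq (leq0n 1) v1) wv).
apply: eq_polyO => i _; rewrite addrA subrK [1 + _]addrC subrK.
by rewrite /eval_nt horner_comp -/(comp_poly _ _) horner_comp.
Qed.

Lemma polyO_take_poly K X (r : {poly {poly R}}) :
  polyO K (fun i => X i - eval_nt r i) ->
  polyO K (fun i => X i - \sum_(j < K) (r`_j).[(n i)%:R] * t i ^+ j).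
Proof.
move=> Xr; have := polyOD Xr (polyO_eval_ntMXn (drop_poly K r) K).
apply: eq_polyO => i _; rewrite -[in eval_nt r](poly_take_drop K r).
rewrite /eval_nt !hornerD opprD addrA subrK; congr (_ - _).
rewrite horner_poly horner_sum; apply: eq_bigr => j _.
by rewrite hornerM horner_exp hornerC.
Qed.

End polynomial_bigO.

Section free_energy_expansion.
Context {R : realType} (nu : nat).
Hypothesis nu_gt0 : (0 < nu)%N.
Implicit Types (n N B J : nat) (u t : R).

Lemma ln_partition_function_expansion J : exists (P : nat -> {poly R}) B,
  forall n N u t, (0 < N)%N -> 0 <= u -> t = u / N%:R ^+ nu.-1 ->
    n.+2%:R ^+ B * t <= 1 ->
    `|ln (partition_function nu n N u / partition_function nu n N 0) -
      \sum_(j < J.+1) (P j).[n%:R] * t ^+ j| <= n.+2%:R ^+ B * t ^+ J.+1.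
Proof.
have [p [p0 /(_ J.+1)[q remainder_le]]] := @partition_function_expansion R nu nu_gt0.
pose D := [set i : nat * nat * R | (0 < i.1.2)%N /\ 0 <= i.2].
pose n (i : nat * nat * R) := i.1.1.
pose t (i : nat * nat * R) := i.2 / i.1.2%:R ^+ nu.-1.
pose X (i : nat * nat * R) :=
  partition_function nu i.1.1 i.1.2 i.2 / partition_function nu i.1.1 i.1.2 0.
have t_ge0 i : D i -> 0 <= t i by move=> [N0 u0]; rewrite divr_ge0.
have poly0 : (\poly_(j < J.+1) p j)`_0 = 1 by rewrite coef_poly.
have Xp : polyO D n t J.+1 (fun i => X i - eval_nt n t (\poly_(j < J.+1) p j) i).
  have [B q_bound] := polyO_eval_ntMXn n t_ge0 q%:P J.+1.
  exists B => -[[n' N'] u] [N0 u0] reg.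
  apply: le_trans (q_bound _ (conj N0 u0) reg); apply: le_trans (ler_norm _).
  rewrite /eval_nt hornerM hornerXn hornerC hornerM horner_exp hornerC.
  have := remainder_le n' N' u _ N0 u0 erefl; congr (`|_ - _| <= _).
  rewrite horner_poly horner_sum; apply: eq_bigr => j _.
  by rewrite hornerM horner_exp hornerC.
have [r /(polyO_take_poly t_ge0)[B ln_bound]] := polyO_ln t_ge0 poly0 Xp.
exists (fun j => r`_j), B => n' N' u t' N0 u0 ->; exact: (ln_bound ((n', N'), u)).
Qed.

Definition free_energy_taylor (P : nat -> {poly R}) J n N u :=
  \sum_(j < J.+1) (P j).[n%:R] / (n%:R ^+ 2 * N%:R ^+ (nu.-1 * j)) * u ^+ j.

Lemma free_energy_expansion J : exists (P : nat -> {poly R}) B,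
  forall n N u, (0 < n)%N -> (0 < N)%N -> 0 <= u -> n.+2%:R ^+ B * u <= 1 ->
  `|free_energy nu n N u - free_energy_taylor P J n N u| <= n.+2%:R ^+ B * u ^+ J.+1.
Proof.
have [P [B ln_bound]] := ln_partition_function_expansion J.
exists P, B => n N u n0 N0 u0 reg; pose t := u / N%:R ^+ nu.-1.
have N1 : 1 <= N%:R ^+ nu.-1 :> R by rewrite exprn_ege1// ler1n.
have t0 : 0 <= t by rewrite divr_ge0.
have tu : t <= u by rewrite ler_pdivrMr ?(lt_le_trans ltr01)// ler_peMr.
rewrite (_ : _ - _ = (n%:R ^+ 2)^-1 *
    (ln (partition_function nu n N u / partition_function nu n N 0) -
     \sum_(j < J.+1) (P j).[n%:R] * t ^+ j)); last first.
  rewrite mulrBr mulr_sumr; congr (_ - _); apply: eq_bigr => j _.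
  by rewrite /t expr_div_n -exprM invfM; ring.
rewrite normrM ger0_norm ?invr_ge0 ?exprn_ge0//.
apply: (@le_trans _ _ (n.+2%:R ^+ B * t ^+ J.+1)).
  rewrite (le_trans _ (ln_bound n N u t N0 u0 erefl _))//.
    by rewrite ler_piMl// invf_le1 ?exprn_ege1 ?exprn_gt0 ?ltr0n ?ler1n.
  by rewrite (le_trans _ reg)// ler_wpM2l// exprn_ge0.
by rewrite ler_wpM2l ?exprn_ge0// lerXn2r ?nnegrE.
Qed.

End free_energy_expansion.

(** * Power series *)

Lemma limit_point_invn (R : realType) (E : set R) :
  (\forall k \near \oo, E k.+1%:R^-1) -> limit_point E 0.
Proof.
move=> nearE U /(@cvg_harmonic R) nearU; near \oo => k.
exists k.+1%:R^-1; split; first by rewrite invr_eq0 pnatr_eq0.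
  by near: k.
by near: k.
Unshelve. all: by end_near. Qed.

Section power_series.
Context {R : realType}.
Implicit Types (a b : nat -> R) (h : R -> R) (p q : {poly R}) (c r s y : R).

Definition has_pseries a h r := forall y, `|y| < r -> pseries a y @ \oo --> h y.

Lemma has_pseries_tail a h r s J : 0 < s < r -> has_pseries a h r ->
  exists2 C : R, 0 <= C & forall y, `|y| <= s ->
    `|h y - \sum_(k < J) a k * y ^+ k| <= C * `|y| ^+ J.
Proof.
move=> /andP[s0 sr] ah; pose absa k : R := `|a k|.
have terms_ge0 k : 0 <= absa k * s ^+ k.
  by rewrite mulr_ge0 ?exprn_ge0 ?(ltW s0) ?normr_ge0.
have abs_cvg : cvgn (pseries absa s).
  apply: (@is_cvg_pseries_inside_norm _ _ ((s + r) / 2)).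
    by apply/cvg_ex; exists (h ((s + r) / 2)); apply: ah; rewrite gtr0_norm; lra.
  by rewrite !gtr0_norm; lra.
have abs_le n : pseries absa s n <= limn (pseries absa s).
  apply: nondecreasing_cvgn_le abs_cvg n => //; apply/nondecreasing_seqP => n.
  by rewrite /pseries /series/= big_nat_recr//= lerDl terms_ge0.
exists (limn (pseries absa s) / s ^+ J).
  rewrite divr_ge0 ?exprn_ge0 ?(ltW s0)// (le_trans _ (abs_le 0%N))//.
  by rewrite /pseries /series/= big_geq.
move=> y ys; have term_le k : (J <= k)%N ->
    `|a k * y ^+ k| <= absa k * s ^+ k * (`|y| / s) ^+ J.
  move=> Jk; rewrite normrM normrX -mulrA ler_wpM2l// -{1 2}(subnK Jk) !exprD.
  rewrite -mulrA -exprMn mulrCA divff ?gt_eqF// mulr1 ler_wpM2r ?exprn_ge0//.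
  by rewrite lerXn2r ?nnegrE// ltW.
have partial_tail n : (J <= n)%N -> `|pseries a y n - \sum_(k < J) a k * y ^+ k| <=
    limn (pseries absa s) / s ^+ J * `|y| ^+ J.
  move=> Jn; rewrite -(big_mkord xpredT (fun k => a k * y ^+ k)).
  rewrite /pseries [X in X - _](big_cat_nat (n := J))//= addrAC subrr add0r.
  rewrite (le_trans (ler_norm_sum _ _ _))// big_nat.
  rewrite (le_trans (ler_sum _ (fun k Jkn => term_le k (proj1 (andP Jkn)))))//.
  rewrite -big_nat -mulr_suml expr_div_n mulrAC -mulrA ler_wpM2r//.
    by rewrite divr_ge0 ?exprn_ge0// ltW.
  rewrite (le_trans _ (abs_le n))// [leRHS](big_cat_nat (n := J))//=.
  by rewrite lerDr sumr_ge0.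
apply: (cvgr_to_le (cvg_norm (cvgB (ah y (le_lt_trans ys sr)) (cvg_cst _)))).
by near=> n; apply: partial_tail; near: n; exact: nbhs_infty_ge.
Unshelve. all: by end_near. Qed.

Lemma has_pseries_tail_family (I : finType) (a : I -> nat -> R) (h : I -> R -> R)
    (delta : I -> R) J :
  (forall g, 0 < delta g) -> (forall g, has_pseries (a g) (h g) (delta g)) ->
  exists2 A : R, 0 <= A & forall (w : I -> R) (u : R), (forall g, 0 <= w g <= 1) ->
    0 <= u -> A * u <= 1 ->
    `|\sum_g h g u * w g - \sum_g (\sum_(i < J) a g i * u ^+ i) * w g| <= A * u ^+ J.
Proof.
move=> delta0 ah; pose s g := delta g / 2.
have tail g : exists C : R, 0 <= C /\ forall u, 0 <= u -> u <= s g ->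
    `|h g u - \sum_(i < J) a g i * u ^+ i| <= C * u ^+ J.
  have sg : 0 < s g < delta g by rewrite /s; have := delta0 g; lra.
  have [C C0 tail_le] := has_pseries_tail J sg (ah g).
  by exists C; split=> // u u0; have := tail_le u; rewrite ger0_norm.
have [C tail_le] := choice tail.
have terms_ge0 g : 0 <= C g + (s g)^-1.
  by have [C0 _] := tail_le g; rewrite addr_ge0// invr_ge0 divr_ge0// ltW.
pose A := \sum_g (C g + (s g)^-1).
exists A => [|w u w01 u0 Au]; first exact: sumr_ge0.
have term_le g : C g + (s g)^-1 <= A.
  by rewrite /A (bigD1 g)//= lerDl sumr_ge0.
have us g : u <= s g.
  have sg : 0 < s g by rewrite divr_gt0.
  rewrite -[s g]mul1r -ler_pdivrMr// mulrC (le_trans _ Au)// ler_wpM2r//.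
  by rewrite (le_trans _ (term_le g))// lerDr; have [] := tail_le g.
rewrite -sumrB (le_trans (ler_norm_sum _ _ _))// mulr_suml; apply: ler_sum => g _.
have [C0 /(_ u u0 (us g)) tail_g] := tail_le g; have /andP[w0 w1] := w01 g.
rewrite -mulrBl normrM (ger0_norm w0) (le_trans (ler_piMr _ w1))//.
by rewrite (le_trans tail_g)// ler_wpM2r ?exprn_ge0// lerDl invr_ge0 divr_ge0// ltW.
Qed.

Lemma has_pseriesD a b h1 h2 r : has_pseries a h1 r -> has_pseries b h2 r ->
  has_pseries (fun k => a k + b k) (fun y => h1 y + h2 y) r.
Proof.
move=> ah bh y yr; rewrite (_ : pseries _ y = fun n => pseries a y n + pseries b y n).
  by apply: cvgD; [exact: ah|exact: bh].
apply/funext => n; rewrite /pseries /series /= -big_split.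
by apply: eq_bigr => k _; rewrite mulrDl.
Qed.

Lemma has_pseriesZ a h r c : has_pseries a h r ->
  has_pseries (fun k => c * a k) (fun y => c * h y) r.
Proof.
move=> ah y yr; rewrite (_ : pseries _ y = fun n => c * pseries a y n).
  by apply: cvgM; [exact: cvg_cst|exact: ah].
apply/funext => n; rewrite /pseries /series /= mulr_sumr.
by apply: eq_bigr => k _; rewrite mulrA.
Qed.

Lemma has_pseriesMX a h r : has_pseries a h r ->
  has_pseries (fun k => if k is k'.+1 then a k' else 0) (fun y => h y * y) r.
Proof.
move=> ah y yr; rewrite -cvg_shiftS.
rewrite (_ : (fun n => _) = fun n => pseries a y n * y).
  by apply: cvgM; [exact: ah|exact: cvg_cst].
apply/funext => n; rewrite /pseries /series /= big_nat_recl// mul0r add0r mulr_suml.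
by apply: eq_bigr => k _; rewrite exprSr mulrA.
Qed.

Lemma has_pseries1 r : has_pseries (fun k => (k == 0)%:R) (fun=> 1) r.
Proof.
move=> y _; rewrite -cvg_shiftS (_ : (fun n => _) = cst 1); first exact: cvg_cst.
apply/funext => n; rewrite /pseries /series /= big_nat_recl// mulr1 big1 ?addr0// => k _.
by rewrite mul0r.
Qed.

Lemma has_pseriesM_horner a h r p : has_pseries a h r ->
  exists b, has_pseries b (fun y => p.[y] * h y) r.
Proof.
move=> ah; elim/poly_ind: p => [|p c [b bh]].
  exists (fun k => 0 * a k) => y yr.
  by have := has_pseriesZ (c := 0) ah yr; rewrite horner0.
eexists => y yr; rewrite hornerMXaddC mulrDl mulrAC.
exact: (has_pseriesD (has_pseriesMX bh) (has_pseriesZ (c := c) ah) yr).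
Qed.

Lemma has_pseries_limit_point_eq0 a h r : 0 < r -> has_pseries a h r ->
  limit_point [set y | h y = 0] 0 -> forall k, a k = 0.
Proof.
move=> r0 ah h0; elim/ltn_ind => k ih; have r2 : 0 < r / 2 < r by lra.
have [C C0 tail_le] := has_pseries_tail k.+1 r2 ah.
apply/eqP; apply: contraT => ak0.
have e0 : 0 < Num.min (r / 2) (`|a k| / (C + 1)).
  by rewrite lt_min divr_gt0//= divr_gt0 ?normr_gt0// ltr_pwDr.
have [y [y_neq0 hy]] := h0 _ (nbhsx_ballx 0 _ e0).
rewrite /ball/= sub0r normrN lt_min => /andP[yr ya].
have := tail_le y (ltW yr); rewrite hy sub0r normrN.
rewrite big_ord_recr/= big1 ?add0r; last first.
  by move=> i _; rewrite ih// mul0r.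
rewrite normrM normrX exprS mulrA ler_pM2r ?exprn_gt0 ?normr_gt0// => aC.
move: ya; rewrite ltr_pdivlMr ?ltr_pwDr// mulrDr mulr1.
by have := normr_gt0 y; rewrite y_neq0; lra.
Qed.

Lemma has_pseries_limit_point_eq a b h1 h2 r : 0 < r ->
  has_pseries a h1 r -> has_pseries b h2 r ->
  limit_point [set y | h1 y = h2 y] 0 -> a = b.
Proof.
move=> r0 ah bh h12; apply/funext => k; apply/eqP; rewrite -subr_eq0 -mulN1r; apply/eqP.
apply: (has_pseries_limit_point_eq0 r0 (has_pseriesD ah (has_pseriesZ (c := -1) bh))).
move=> U /h12[y [y0 hy Uy]]; exists y; split=> //=.
by rewrite hy mulN1r subrr.
Qed.

Lemma has_pseries_unique a b h r : 0 < r ->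
  has_pseries a h r -> has_pseries b h r -> a = b.
Proof.
move=> r0 ah bh; apply: (has_pseries_limit_point_eq r0 ah bh) => U U0.
near (0 : R)^' => y; exists y; split=> //; near: y; first exact: nbhs_dnbhs_neq.
exact: nbhs_dnbhs.
Unshelve. all: by end_near. Qed.

Lemma has_pseries_identity a b h1 h2 r : 0 < r ->
  has_pseries a h1 r -> has_pseries b h2 r ->
  limit_point [set y | h1 y = h2 y] 0 -> forall y, `|y| < r -> h1 y = h2 y.
Proof.
move=> r0 ah bh h12 y yr; have ab := has_pseries_limit_point_eq r0 ah bh h12.
have := bh y yr; rewrite -ab.
exact: (cvg_unique (@norm_hausdorff _ R) (ah y yr)).
Qed.

Lemma has_pseries_horner_identity a h r p q : 0 < r -> has_pseries a h r ->
  limit_point [set y | p.[y] * h y = q.[y]] 0 ->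
  forall y, `|y| < r -> p.[y] * h y = q.[y].
Proof.
move=> r0 ah; have [b bh] := has_pseriesM_horner p ah.
have [c ch] := has_pseriesM_horner q (@has_pseries1 r).
apply: (has_pseries_identity r0 bh) => y yr.
by have := ch y yr; rewrite mulr1; exact.
Qed.

End power_series.

Section double_series.
Context {R : realType} (t : nat -> nat -> R).
Implicit Types (m p k l : nat).

Definition rectangle_sum m p := \sum_(k < m) \sum_(l < p) t k l.

Definition rectangle_abs_sum m p := \sum_(k < m) \sum_(l < p) `|t k l|.

Hypothesis t_summable : summable [set: nat * nat] (fun kl => (t kl.1 kl.2)%:E).

Lemma rectangle_abs_sum_bounded : exists M, forall m p, rectangle_abs_sum m p <= M.
Proof.
move: t_summable; rewrite /summable; set E := (\esum_(x in _) _)%E => E_fin.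
exists (fine E) => m p; rewrite -lee_fin fineK; last by rewrite ge0_fin_numE// esum_ge0.
pose s := [seq (k, l) | k <- iota 0 m, l <- iota 0 p].
apply: esum_ge; exists [set` s]; first by split; [exact: finite_seq|exact: subsetT].
rewrite -fsbig_seq; last first.
  by rewrite allpairs_uniq ?iota_uniq// => -[? ?] [? ?] _ _ /= [-> ->].
rewrite sumEFin lee_fin le_eqVlt; apply/orP; left; apply/eqP.
rewrite big_allpairs_dep/= /rectangle_abs_sum.
rewrite -(big_mkord xpredT (fun k => \sum_(l < p) `|t k l|)) /index_iota subn0.
apply: eq_bigr => k _.
by rewrite -(big_mkord xpredT (fun l => `|t k l|)) /index_iota subn0.
Qed.

Lemma rectangle_abs_sum_le m m' p p' : (m <= m')%N -> (p <= p')%N ->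
  rectangle_abs_sum m p <= rectangle_abs_sum m' p'.
Proof.
move=> mm pp; rewrite /rectangle_abs_sum.
apply: (@le_trans _ _ (\sum_(k < m) \sum_(l < p') `|t k l|)).
  apply: ler_sum => k _; rewrite -(subnKC pp) big_split_ord/= lerDl.
  by apply: sumr_ge0.
rewrite -(subnKC mm) big_split_ord/= lerDl.
by apply: sumr_ge0 => k _; apply: sumr_ge0.
Qed.

Lemma is_cvg_column_series l : cvgn (series (t^~ l)).
Proof.
have [M sum_le] := rectangle_abs_sum_bounded.
apply: normed_cvg; apply: nondecreasing_is_cvgn.
  apply/nondecreasing_seqP => m.
  by rewrite -[leRHS]/(series (fun k => `|t k l|) m.+1) seriesSr lerDl.
exists M => _ [m _ <-]; apply: le_trans (sum_le m l.+1).
rewrite -[leLHS]/(series (fun k => `|t k l|) m) seriesEord; apply: ler_sum => k _.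
by rewrite big_ord_recr/= lerDr sumr_ge0.
Qed.

Let is_cvg_square_abs_sum : cvgn (fun m => rectangle_abs_sum m m).
Proof.
have [M sum_le] := rectangle_abs_sum_bounded; apply: nondecreasing_is_cvgn.
  by move=> m p mp; exact: rectangle_abs_sum_le.
by exists M => _ [m _ <-].
Qed.

Lemma rectangle_sum_dist_le m p : (m <= p)%N ->
  `|rectangle_sum p m - rectangle_sum m m| <=
  rectangle_abs_sum p p - rectangle_abs_sum m m.
Proof.
move=> mp; rewrite lerBrDl (le_trans _ (rectangle_abs_sum_le (leqnn p) mp))//.
rewrite /rectangle_abs_sum /rectangle_sum -(subnKC mp) !big_split_ord/= lerD2l.
rewrite addrAC subrr add0r (le_trans (ler_norm_sum _ _ _))//.
by apply: ler_sum => k _; exact: ler_norm_sum.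
Qed.

Lemma column_sums_dist_le m :
  `|\sum_(l < m) limn (series (t^~ l)) - rectangle_sum m m| <=
  limn (fun p => rectangle_abs_sum p p) - rectangle_abs_sum m m.
Proof.
have columns_cvg : (fun p => rectangle_sum p m) @ \oo -->
    \sum_(l < m) limn (series (t^~ l)).
  rewrite /rectangle_sum; under eq_cvg do rewrite exchange_big.
  apply: cvg_big => [|l _]; first exact: add_continuous.
  under eq_cvg do rewrite -(big_mkord xpredT (t^~ l)).
  exact: is_cvg_column_series.
apply: (cvgr_to_le (cvg_norm (cvgB columns_cvg (cvg_cst _)))); near=> p.
have mp : (m <= p)%N by near: p; exact: nbhs_infty_ge.
rewrite (le_trans (rectangle_sum_dist_le mp))// lerD2r.
apply: (nondecreasing_cvgn_le _ is_cvg_square_abs_sum) => i j ij.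
exact: rectangle_abs_sum_le.
Unshelve. all: by end_near. Qed.

Lemma cvg_column_sums (v : R) : rectangle_sum m m @[m --> \oo] --> v ->
  series (fun l => limn (series (t^~ l))) @ \oo --> v.
Proof.
move=> tv; rewrite -[v]add0r.
rewrite (_ : series _ = fun m =>
  (\sum_(l < m) limn (series (t^~ l)) - rectangle_sum m m) + rectangle_sum m m);
  last first.
  by apply/funext => m; rewrite subrK /series/= big_mkord.
apply: cvgD => //; apply/norm_cvg0P.
apply: (@squeeze_cvgr _ _ _ _ (fun=> 0)
  (fun m => limn (fun p => rectangle_abs_sum p p) - rectangle_abs_sum m m)).
- by near=> m; rewrite normr_ge0 column_sums_dist_le.
- exact: cvg_cst.
- rewrite -(subrr (limn (fun p => rectangle_abs_sum p p))).
  by apply: cvgB; [exact: cvg_cst|exact: is_cvg_square_abs_sum].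
Unshelve. all: by end_near. Qed.

End double_series.

Lemma analytic_on_box_coefficient (R : realType) (f : R -> R -> R)
    (x0 rho delta : R) (al : nat -> R -> R) : 0 < delta ->
  analytic_on_box f x0 0 rho delta ->
  (forall x, `|x - x0| < rho -> has_pseries (al^~ x) (f x) delta) ->
  forall j, exists a, has_pseries a (fun y => al j (x0 + y)) rho.
Proof.
move=> d0 [a ha] alf j; exists (a^~ j) => y yr.
pose t u k l := a k l * y ^+ k * u ^+ l.
have yE : x0 + y - x0 = y by rewrite addrC addKr.
have box_sum (u : R) : `|u| < delta ->
    summable [set: nat * nat] (fun kl => (t u kl.1 kl.2)%:E) /\
    rectangle_sum (t u) m m @[m --> \oo] --> f (x0 + y) u.
  by move=> ud; have := ha (x0 + y) u; rewrite yE subr0; exact.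
have columnE u l : series ((t u)^~ l) = fun n => pseries (a^~ l) y n * u ^+ l.
  by apply/funext => n; rewrite /pseries /series/= mulr_suml.
have is_cvg_column l : cvgn (pseries (a^~ l) y).
  have d2 : `|delta / 2| < delta by rewrite gtr0_norm ?divr_gt0//; lra.
  have [/is_cvg_column_series/(_ l) + _] := box_sum _ d2; rewrite columnE => c.
  have -> : pseries (a^~ l) y =
      fun n => pseries (a^~ l) y n * (delta / 2) ^+ l / (delta / 2) ^+ l.
    by apply/funext => n; rewrite mulfK// expf_neq0// gt_eqF// divr_gt0.
  by apply: is_cvgM => //; exact: is_cvg_cst.
have column_sums : has_pseries (fun l => limn (pseries (a^~ l) y)) (f (x0 + y)) delta.
  move=> u ud; have [/cvg_column_sums sums /sums] := box_sum u ud.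
  rewrite (_ : (fun l => limn _) = fun l => limn (pseries (a^~ l) y) * u ^+ l)//.
  apply/funext => l; rewrite columnE limM//; last exact: is_cvg_cst.
  by rewrite lim_cst//; exact: norm_hausdorff.
have alf_y : has_pseries (al^~ (x0 + y)) (f (x0 + y)) delta by apply: alf; rewrite yE.
rewrite [al j _](congr1 (@^~ j) (has_pseries_unique d0 alf_y column_sums)).
exact: is_cvg_column.
Qed.

(** * Comparison of the two expansions *)

Section dilate_poly.
Context {R : comNzRingType}.
Implicit Types (c y : R) (p : {poly R}).

Definition dilate_poly c p := \poly_(i < size p) (p`_i * c ^+ i).

Lemma horner_dilate_poly c p y : (dilate_poly c p).[y] = p.[c * y].
Proof.
rewrite horner_poly horner_coef; apply: eq_bigr => i _.
by rewrite exprMn mulrA.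
Qed.

Lemma coef_dilate_poly c p i : (dilate_poly c p)`_i = p`_i * c ^+ i.
Proof. by rewrite coef_poly; case: ltnP => // pi; rewrite nth_default ?mul0r. Qed.

End dilate_poly.

Section coefficient_extraction.
Context {R : realType}.
Implicit Types (A : {poly R}) (C x : R).

Lemma lead_coef_le_horner A x : 1 <= x -> `|lead_coef A| * x ^+ size A <=
  x * `|A.[x]| + (\sum_(i < size A) `|A`_i|) * x ^+ (size A).-1.
Proof.
move=> x1; have x0 : 0 <= x by rewrite (le_trans ler01).
have [->|A_neq0] := eqVneq A 0.
  by rewrite lead_coef0 normr0 mul0r addr_ge0 ?mulr_ge0 ?exprn_ge0 ?sumr_ge0.
have := A_neq0; rewrite -size_poly_gt0 => A_gt0.
move: (lead_coefE A) (horner_coef A x); case: (size A) A_gt0 => // s _ /= -> ->.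
rewrite !big_ord_recr/= [in leRHS]mulrDl exprS mulrCA.
have := ler_normB (\sum_(i < s) A`_i * x ^+ i + A`_s * x ^+ s)
  (\sum_(i < s) A`_i * x ^+ i).
rewrite addrAC subrr add0r normrM (ger0_norm (exprn_ge0 s x0)).
move=> /(ler_wpM2l x0)/le_trans; apply; rewrite mulrDr lerD2l.
rewrite (le_trans (ler_wpM2l x0 (ler_norm_sum _ _ _)))//.
rewrite ler_wpDr ?mulr_ge0 ?exprn_ge0// mulr_sumr mulr_suml; apply: ler_sum => i _.
rewrite normrM normrX (ger0_norm x0) mulrCA -exprS ler_wpM2l//.
by rewrite ler_weXn2l.
Qed.

Lemma poly_growth_coef0 A C p q i :
  (\forall m \near \oo, `|A.[m%:R]| * m%:R ^+ p <= C * m%:R ^+ q) ->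
  (q < i + p)%N -> A`_i = 0.
Proof.
move=> growth qip; apply/eqP; apply: contraT => Ai_neq0.
have lead0 : 0 < `|lead_coef A|.
  by rewrite normr_gt0 lead_coef_eq0; apply: contraNneq Ai_neq0 => ->; rewrite coef0.
have iA : (i < size A)%N by rewrite ltnNge; apply: contraNN Ai_neq0 => /leq_sizeP->.
pose S := \sum_(j < size A) `|A`_j|.
suff : \forall m \near \oo, `|lead_coef A| * m%:R <= `|C| + S.
  move=> bounded; near \oo => m.
  have : (`|C| + S) / `|lead_coef A| + 1 <= m%:R by near: m; exact: nbhs_infty_ger.
  have : `|lead_coef A| * m%:R <= `|C| + S by near: m.
  by rewrite mulrC -ler_pdivlMr//; lra.
near=> m; have m1 : 1 <= m%:R :> R by rewrite ler1n; near: m; exact: nbhs_infty_gt.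
have m0 : 0 < m%:R :> R by rewrite (lt_le_trans ltr01).
rewrite -(ler_pM2r (exprn_gt0 ((size A).-1 + p) m0)) exprD.
have := ler_wpM2r (exprn_ge0 p (ltW m0)) (lead_coef_le_horner A m1).
rewrite -[in m%:R ^+ size A](prednK (leq_ltn_trans (leq0n i) iA)) exprS -/S.
rewrite mulrDl => lead_le.
have gm : `|A.[m%:R]| * m%:R ^+ p <= C * m%:R ^+ q by near: m.
have : m%:R * (`|A.[m%:R]| * m%:R ^+ p) <= `|C| * (m%:R ^+ (size A).-1 * m%:R ^+ p).
  rewrite (le_trans (ler_wpM2l (ltW m0) gm))// mulrCA -exprS -exprD.
  rewrite (le_trans (ler_wpM2r _ (ler_norm C))) ?exprn_ge0 ?(ltW m0)// ler_wpM2l//.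
  by rewrite ler_weXn2l//; lia.
by move: lead_le; rewrite !mulrA; lra.
Unshelve. all: by end_near. Qed.

Lemma poly_inverse_powers_coef A (b : nat -> R) C (d L G K : nat) :
  (0 < d)%N -> (G <= K)%N ->
  (\forall m \near \oo,
    `|A.[m%:R] / m%:R ^+ L - \sum_(g < K.+1) b g / m%:R ^+ (d * g)|
      * m%:R ^+ (d * G).+1 <= C) ->
  b G = if (L < d * G)%N then 0 else A`_(L - d * G).
Proof.
move=> d0 GK remainder_le.
pose D := 'X^(d * K) * A - \sum_(g < K.+1) b g *: 'X^(L + d * (K - g)).
have : D`_(L + d * (K - G)) = 0.
  apply: (@poly_growth_coef0 D C (d * G).+1 (L + d * K)); last by nia.
  near=> m; have m0 : 0 < m%:R :> R by rewrite ltr0n; near: m; exact: nbhs_infty_gt.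
  have -> : D.[m%:R] = m%:R ^+ (L + d * K) *
      (A.[m%:R] / m%:R ^+ L - \sum_(g < K.+1) b g / m%:R ^+ (d * g)).
    rewrite /D hornerD hornerN hornerM hornerXn horner_sum mulrBr mulr_sumr.
    congr (_ - _).
      by rewrite exprD; field; rewrite expf_neq0 ?gt_eqF.
    apply: eq_bigr => g _; rewrite hornerZ hornerXn.
    rewrite (_ : L + d * K = L + d * (K - g) + d * g)%N; last first.
      by have := ltn_ord g; nia.
    by rewrite [m%:R ^+ (_ + d * g)]exprD; field; rewrite expf_neq0 ?gt_eqF.
  rewrite normrM (ger0_norm (exprn_ge0 _ (ltW m0))) -mulrA mulrC.
  by rewrite ler_wpM2r ?exprn_ge0 ?(ltW m0)//; near: m.
rewrite coefB coefXnM coef_sum (bigD1 (Ordinal (GK : (G < K.+1)%N)))//=.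
rewrite coefZ coefXn eqxx mulr1 big1 ?addr0 => [|g gG].
  move/eqP; rewrite subr_eq0 => /eqP <-.
  rewrite (_ : (L + d * (K - G) < d * K)%N = (L < d * G)%N); last by nia.
  by case: ifP => // _; congr (A`_ _); nia.
rewrite coefZ coefXn (_ : _ == _ = false) ?mulr0//.
apply/eqP => /eqP; rewrite eqn_add2l eqn_pmul2l// => /eqP KG.
by move/eqP: gG; apply; apply: val_inj => /=; have := ltn_ord g; lia.
Unshelve. all: by end_near. Qed.

Lemma coefficient_le_samples J : exists2 C : R, 0 <= C &
  forall (c : nat -> R) (E : R),
    (forall s : nat, (0 < s <= J.+1)%N -> `|\sum_(i < J.+1) c i * s%:R ^+ i| <= E) ->
    `|c J| <= C * E.
Proof.
pose a : 'rV[R]_J.+1 := \row_s (nat_of_ord s).+1%:R.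
pose V := Vandermonde J.+1 a.
have V_unit : V \in unitmx.
  rewrite unitmxE det_Vandermonde unitfE.
  apply/prodf_neq0 => i _; apply/prodf_neq0 => j ij.
  by rewrite !mxE subr_eq0 eqr_nat eqSS gtn_eqF.
exists (\sum_s `|(invmx V) s ord_max|); first exact: sumr_ge0.
move=> c E samples_le; pose v : 'rV[R]_J.+1 := \row_i c i.
have -> : c J = v ord0 ord_max by rewrite mxE.
rewrite -[v](mulmxK V_unit) mxE (le_trans (ler_norm_sum _ _ _))// mulr_suml.
apply: ler_sum => s _; rewrite normrM mulrC ler_wpM2l// mxE.
rewrite (eq_bigr (fun i : 'I_J.+1 => c i * s.+1%:R ^+ i)); last first.
  by move=> i _; rewrite !mxE.
exact: (samples_le s.+1 (ltn_ord s)).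
Qed.

(* Sample at the points [u = s / m ^ (B + p)] with [1 <= s <= J + 1]. *)
Lemma top_coefficient_decay (d : nat -> nat -> R) (A : R) B J p q :
  0 <= A -> (0 < p)%N -> ((B + p) * J + p <= q)%N ->
  (\forall m \near \oo, forall u : R, 0 < u -> A * m%:R ^+ B * u <= 1 ->
    `|\sum_(i < J.+1) d m i * u ^+ i| <= A * (m%:R ^+ B * u ^+ J.+1 + m%:R ^- q)) ->
  exists C, \forall m \near \oo, `|d m J| * m%:R ^+ p <= C.
Proof.
move=> A0 p0 qge series_bound; have [C C0 samples_bound] := coefficient_le_samples J.
pose S : R := J.+1%:R; pose M := (B + p)%N.
have S0 : 0 <= S by [].
exists (C * (A * (S ^+ J.+1 + 1))).
apply: filterS3 (nbhs_infty_gt 0) (nbhs_infty_ger (A * S)) series_bound.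
move=> m m_gt0 AS series_bound; have m1 : 1 <= m%:R :> R by rewrite ler1n.
have m0 : 0 < m%:R :> R by rewrite ltr0n.
have mX a : 0 < m%:R ^+ a :> R by rewrite exprn_gt0.
have := samples_bound (fun i => d m i / m%:R ^+ (M * i))
  (A * (S ^+ J.+1 + 1) / m%:R ^+ (M * J + p)).
rewrite normrM normfV (gtr0_norm (mX _)) ler_pdivrMr// exprD invfM => top_le.
rewrite -ler_pdivlMr// (le_trans (top_le _))//; last first.
  by rewrite le_eqVlt; apply/orP; left; apply/eqP; field; rewrite !expf_neq0 ?gt_eqF.
move=> s /andP[s0 sJ]; pose u : R := s%:R / m%:R ^+ M.
have u0 : 0 < u by rewrite divr_gt0// ltr0n.
have sS : s%:R <= S by rewrite ler_nat.
rewrite (eq_bigr (fun i : 'I_J.+1 => d m i * u ^+ i)); last first.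
  by move=> i _; rewrite /u expr_div_n -exprM mulrAC mulrA.
have small_u : A * m%:R ^+ B * u <= 1.
  rewrite /u /M exprD (_ : _ * _ = A * s%:R / m%:R ^+ p); last first.
    by field; rewrite !expf_neq0 ?gt_eqF.
  rewrite ler_pdivrMr// mul1r (le_trans (ler_wpM2l A0 sS))// (le_trans AS)//.
  by rewrite -(prednK p0) exprS ler_peMr ?exprn_ege1// ltW.
rewrite (le_trans (series_bound u u0 small_u))//.
rewrite -mulrA ler_wpM2l// mulrDl mul1r -invfM -exprD lerD//.
  rewrite /u expr_div_n -exprM mulnS {1}/M -addnA [(p + _)%N]addnC exprD invfM.
  rewrite mulrCA mulVKf ?gt_eqF// ler_wpM2r ?invr_ge0 ?(ltW (mX _))//.
  by rewrite lerXn2r ?nnegrE.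
by rewrite lef_pV2 ?posrE// ler_weXn2l.
Qed.

End coefficient_extraction.

Lemma scaling_exponentE nu g j : (0 < nu)%N ->
  scaling_exponent nu g j = (nu.-1 * j)%:Z - (2 * g)%:Z.
Proof.
case: nu => // nu _; rewrite /scaling_exponent !PoszM mulrC; congr (_ * _ - _).
by rewrite /=; lia.
Qed.

Lemma expfz_scaling_exponent (R : realType) nu g j (x : R) : (0 < nu)%N -> 0 < x ->
  x ^+ (2 * g) * x ^ scaling_exponent nu g j = x ^+ (nu.-1 * j).
Proof.
move=> nu0 x0; rewrite !exprnP -expfzDr ?gt_eqF//; congr (_ ^ _).
by rewrite scaling_exponentE//; lia.
Qed.

Section topological_comparison.
Context {R : realType} (nu : nat) (f : nat -> R -> R -> R) (rho delta : nat -> R).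
Context (alpha : nat -> nat -> R -> R).
Hypothesis nu_gt0 : (0 < nu)%N.
Hypothesis rho_gt0 : forall g, 0 < rho g.
Hypothesis delta_gt0 : forall g, 0 < delta g.
Hypothesis f_expansion : topological_expansion nu f.
Hypothesis alpha_coef : forall g x, `|x - 1| < rho g ->
  has_pseries ((alpha g)^~ x) (f g x) (delta g).

Local Notation x k := (1 + k.+1%:R^-1 : R).

Let ratioE k : x k = k.+2%:R / k.+1%:R.
Proof. by rewrite -[k.+2%:R]natr1 mulrDl divff ?pnatr_eq0// mul1r. Qed.

Let dist_ratio1 k : `|x k - 1| = k.+1%:R^-1.
Proof. by rewrite addrC addKr ger0_norm. Qed.

(* From now on [n = (k + 2) m] and [N = (k + 1) m], so that [n / N = x k]. *)
Definition alpha_expansion K J k m (u : R) :=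
  \sum_(g < K.+1) (\sum_(i < J.+1) alpha g i (x k) * u ^+ i) /
    (k.+1 * m)%:R ^+ (2 * g).

Lemma alpha_expansion_tail K J : \forall k \near \oo,
  exists2 A : R, 0 <= A & forall m (u : R), (0 < m)%N -> 0 < u -> A * u <= 1 ->
    `|\sum_(g < K.+1) f g (x k) u / (k.+1 * m)%:R ^+ (2 * g) -
      alpha_expansion K J k m u| <= A * u ^+ J.+1.
Proof.
near=> k.
have k_rho : forall g : 'I_K.+1, k.+1%:R^-1 < rho g.
  near: k; apply: filter_forall => g.
  exact: (near_infty_natSinv_lt (PosNum (rho_gt0 g))).
have f_sum (g : 'I_K.+1) : has_pseries ((alpha g)^~ (x k)) (f g (x k)) (delta g).
  by apply: alpha_coef; rewrite dist_ratio1.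
have [A A0 tail_le] := has_pseries_tail_family J.+1
  (fun g : 'I_K.+1 => delta_gt0 g) f_sum.
exists A => // m u m0 u0 Au; apply: tail_le => //; last exact: ltW.
move=> g; rewrite invr_ge0 exprn_ge0//= invf_le1 ?exprn_gt0 ?exprn_ege1//.
  by rewrite ler1n muln_gt0.
by rewrite ltr0n muln_gt0.
Unshelve. all: by end_near. Qed.

Lemma alpha_expansion_bound K J : \forall k \near \oo,
  exists2 A : R, 0 <= A & \forall m \near \oo, forall u : R, 0 < u -> A * u <= 1 ->
    `|free_energy nu (k.+2 * m) (k.+1 * m) u - alpha_expansion K J k m u|
    <= A * (u ^+ J.+1 + m%:R ^- (2 * K.+1)).
Proof.
have [eps [del [C [N0 [eps0 del0 truncation_le]]]]] := f_expansion K.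
apply: filterS2 (near_infty_natSinv_lt (PosNum eps0)) (alpha_expansion_tail K J).
move=> k k_eps [A A0 tail_le].
pose A' := A + `|C| + 2 / del; have del_ge0 : 0 <= 2 / del by rewrite divr_ge0// ltW.
have AA' : A <= A' by rewrite /A' -addrA lerDl addr_ge0.
have CA' : `|C| <= A' by rewrite /A' addrAC lerDr addr_ge0.
have delA' : 2 / del <= A' by rewrite lerDr addr_ge0.
exists A'; first exact: le_trans AA'.
apply: filterS2 (nbhs_infty_gt 0) (nbhs_infty_ge N0) => m m0 N0m u u0 A'u.
have u_del : u < del.
  have : 2 / del * u <= 1 by rewrite (le_trans _ A'u)// ler_wpM2r ?(ltW u0).
  by rewrite mulrAC ler_pdivrMr//; lra.
have Au : A * u <= 1 by rewrite (le_trans _ A'u)// ler_wpM2r ?(ltW u0).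
have nN : (k.+2 * m)%:R / (k.+1 * m)%:R = x k.
  by rewrite ratioE !natrM -mulf_div divff ?mulr1// pnatr_eq0 -lt0n.
have := truncation_le (k.+2 * m)%N (k.+1 * m)%N u; rewrite nN dist_ratio1 !muln_gt0 m0.
rewrite u0 u_del (leq_trans N0m (leq_pmull _ _))// => /(_ isT isT isT k_eps isT) F_approx.
apply: le_trans (ler_distD
  (\sum_(g < K.+1) f g (x k) u / (k.+1 * m)%:R ^+ (2 * g)) _ _) _.
rewrite (le_trans (lerD F_approx (tail_le m u m0 u0 Au)))// addrC mulrDr lerD//.
  by rewrite ler_wpM2r ?exprn_ge0 ?(ltW u0).
apply: (@le_trans _ _ (`|C| / (k.+1 * m)%:R ^+ (2 * K.+1))).
  by rewrite ler_wpM2r ?ler_norm// invr_ge0 exprn_ge0.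
rewrite ler_pM ?invr_ge0 ?exprn_ge0// lef_pV2 ?posrE ?exprn_gt0 ?ltr0n ?muln_gt0//.
by rewrite lerXn2r ?nnegrE// ler_nat leq_pmull.
Qed.

Definition coefficient_gap (P : nat -> {poly R}) K k m i :=
  (P i).[(k.+2 * m)%:R] / ((k.+2 * m)%:R ^+ 2 * (k.+1 * m)%:R ^+ (nu.-1 * i)) -
  \sum_(g < K.+1) alpha g i (x k) / (k.+1 * m)%:R ^+ (2 * g).

Lemma coefficient_gap_series P K J k m u :
  \sum_(i < J.+1) coefficient_gap P K k m i * u ^+ i =
  free_energy_taylor nu P J (k.+2 * m) (k.+1 * m) u - alpha_expansion K J k m u.
Proof.
rewrite /alpha_expansion; under [X in _ = _ - X]eq_bigr do rewrite mulr_suml.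
rewrite exchange_big/= -sumrB; apply: eq_bigr => i _.
rewrite /coefficient_gap mulrBl; congr (_ - _).
by rewrite mulr_suml; apply: eq_bigr => g _; rewrite mulrAC.
Qed.

Lemma coefficient_gap_series_bound J : exists (P : nat -> {poly R}) B, forall K,
  \forall k \near \oo, exists2 A : R, 0 <= A &
    \forall m \near \oo, forall u : R, 0 < u -> A * m%:R ^+ B * u <= 1 ->
      `|\sum_(i < J.+1) coefficient_gap P K k m i * u ^+ i| <=
      A * (m%:R ^+ B * u ^+ J.+1 + m%:R ^- (2 * K.+1)).
Proof.
have [P [B taylor_bound]] := @free_energy_expansion R nu nu_gt0 J; exists P, B => K.
apply: filterS (alpha_expansion_bound K J) => k [A A0 alpha_bound].
have k4 : 0 <= k.+4%:R ^+ B :> R by rewrite exprn_ge0.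
exists (A + k.+4%:R ^+ B); first exact: addr_ge0.
apply: filterS2 (nbhs_infty_gt 0) alpha_bound => m m0 alpha_bound u u0 Au.
have mB : 1 <= m%:R ^+ B :> R by rewrite exprn_ege1// ler1n.
have nB : (k.+2 * m).+2%:R ^+ B <= k.+4%:R ^+ B * m%:R ^+ B :> R.
  by rewrite -exprMn lerXn2r ?nnegrE ?mulr_ge0// -natrM ler_nat; nia.
have small_u : A * u <= 1.
  rewrite (le_trans _ Au)// ler_wpM2r ?(ltW u0)// (@le_trans _ _ (A * m%:R ^+ B))//.
    by rewrite ler_peMr.
  by rewrite ler_wpM2r ?(le_trans ler01)// lerDl.
have small_nu : (k.+2 * m).+2%:R ^+ B * u <= 1.
  rewrite (le_trans _ Au)// ler_wpM2r ?(ltW u0)// (le_trans nB)//.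
  by rewrite ler_wpM2r ?(le_trans ler01)// lerDr.
have n0 : (0 < k.+2 * m)%N by rewrite muln_gt0.
have N0 : (0 < k.+1 * m)%N by rewrite muln_gt0.
rewrite coefficient_gap_series.
apply: le_trans (ler_distD (free_energy nu (k.+2 * m) (k.+1 * m) u) _ _) _.
rewrite distrC (le_trans (lerD (taylor_bound _ _ _ n0 N0 (ltW u0) small_nu)
  (alpha_bound u u0 small_u)))//.
have uJ : 0 <= u ^+ J.+1 by rewrite exprn_ge0 ?ltW.
have mK : 0 <= m%:R ^- (2 * K.+1) :> R by rewrite invr_ge0 exprn_ge0.
rewrite addrC mulrDl lerD//.
  by rewrite ler_wpM2l// lerD2r ler_peMl.
by rewrite mulrDr ler_wpDr ?mulr_ge0// mulrA ler_wpM2r.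
Qed.

Lemma coefficient_gap_decay G J : exists (P : nat -> {poly R}) K, (G <= K)%N /\
  \forall k \near \oo, exists C, \forall m \near \oo,
    `|coefficient_gap P K k m J| * m%:R ^+ (2 * G).+1 <= C.
Proof.
have [P [B gap_bound]] := coefficient_gap_series_bound J.
pose K := ((B + (2 * G).+1) * J + G)%N.
have exponent_le : ((B + (2 * G).+1) * J + (2 * G).+1 <= 2 * K.+1)%N.
  by rewrite /K; move: (_ * J)%N => e; lia.
exists P, K; split; first exact: leq_addl.
apply: filterS (gap_bound K) => k [A A0].
exact: top_coefficient_decay A0 (ltn0Sn _) exponent_le.
Qed.

Lemma power_law_near_1 G J : exists c : R,
  ((nu.-1 * J + 2 < 2 * G)%N -> c = 0) /\
  \forall k \near \oo, x k ^+ (2 * G) * alpha G J (x k) = c * x k ^+ (nu.-1 * J).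
Proof.
have [P [K [GK gap_decay]]] := coefficient_gap_decay G J; pose L := (nu.-1 * J + 2)%N.
exists (if (L < 2 * G)%N then 0 else (P J)`_(L - 2 * G)); split=> [|].
  by rewrite /L => ->.
apply: filterS gap_decay => k [C gap_decay].
pose Q := (k.+2%:R ^+ 2 * k.+1%:R ^+ (nu.-1 * J))^-1 *: dilate_poly k.+2%:R (P J).
pose b g := alpha g J (x k) / k.+1%:R ^+ (2 * g).
have gapE m : coefficient_gap P K k m J =
    Q.[m%:R] / m%:R ^+ L - \sum_(g < K.+1) b g / m%:R ^+ (2 * g).
  rewrite /coefficient_gap /Q hornerZ horner_dilate_poly natrM /L exprD.
  congr (_ - _); first by rewrite !natrM !exprMn !invfM; ring.
  by apply: eq_bigr => g _; rewrite natrM exprMn invfM mulrA.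
have bE := @poly_inverse_powers_coef R Q b C 2 L G K isT GK.
have -> : x k ^+ (2 * G) * alpha G J (x k) = k.+2%:R ^+ (2 * G) * b G.
  by rewrite /b ratioE expr_div_n; ring.
rewrite bE; last by apply: filterS gap_decay => m; rewrite gapE.
case: ltnP => LG; first by rewrite mulr0 mul0r.
rewrite ratioE expr_div_n coefZ coef_dilate_poly.
have LE : k.+2%:R ^+ (2 * G) * k.+2%:R ^+ (L - 2 * G) =
    k.+2%:R ^+ (nu.-1 * J) * k.+2%:R ^+ 2 :> R by rewrite -!exprD subnKC.
have k1 : k.+1%:R != 0 :> R by rewrite pnatr_eq0.
rewrite [LHS](_ : _ = k.+2%:R ^+ (2 * G) * k.+2%:R ^+ (L - 2 * G) /
  (k.+2%:R ^+ 2 * k.+1%:R ^+ (nu.-1 * J)) * (P J)`_(L - 2 * G)); last by ring.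
by rewrite LE; field; rewrite expf_neq0//= -natrD pnatr_eq0.
Qed.

Hypothesis f_analytic : forall g, analytic_on_box (f g) 1 0 (rho g) (delta g).

Lemma power_law g j : exists c : R, (scaling_exponent nu g j < - 2 -> c = 0) /\
  forall x, 0 < x -> `|x - 1| < rho g -> alpha g j x = c * x ^ scaling_exponent nu g j.
Proof.
have [c [c0 c_near]] := power_law_near_1 g j; exists c; split.
  by move=> D2; apply: c0; move: D2; rewrite scaling_exponentE//; lia.
move=> y y0 y_rho; have [a alpha_a] := analytic_on_box_coefficient (delta_gt0 g)
  (f_analytic g) (alpha_coef (g := g)) j.
apply: (mulfI (expf_neq0 (2 * g) (lt0r_neq0 y0))).
rewrite mulrCA expfz_scaling_exponent//.
have evalE e z : ((1 + 'X : {poly R}) ^+ e).[z] = (1 + z) ^+ e by rewrite !hornerE.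
have := has_pseries_horner_identity
  (p := (1 + 'X) ^+ (2 * g)) (q := c *: (1 + 'X) ^+ (nu.-1 * j))
  (rho_gt0 g) alpha_a _ y_rho.
rewrite hornerZ !evalE (addrC 1 (y - 1)) subrK; apply; apply: limit_point_invn.
by apply: filterS c_near => k /=; rewrite hornerZ !evalE.
Qed.

End topological_comparison.

Theorem theorem2p2 (R : realType) (nu : nat) (hnu : (1 <= nu)%N)
    (f : nat -> R -> R -> R) (rho delta : nat -> R)
    (hrho : forall g, 0 < rho g) (hdelta : forall g, 0 < delta g)
    (hanalytic : forall g, analytic_on_box (f g) 1 0 (rho g) (delta g))
    (hexpansion : topological_expansion nu f)
    (alpha : nat -> nat -> R -> R)
    (halpha : forall (g : nat) (x u : R),
        `|x - 1| < rho g -> `|u| < delta g ->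
        series (fun j : nat => alpha g j x * u ^+ j) @ \oo --> f g x u) :
  exists c : nat -> nat -> R, forall g j : nat,
    (forall x : R, 0 < x -> `|x - 1| < rho g ->
       alpha g j x = c g j * x ^ scaling_exponent nu g j) /\
    (scaling_exponent nu g j < - 2 ->
       c g j = 0 /\
       forall x : R, 0 < x -> `|x - 1| < rho g -> alpha g j x = 0).
Proof.
have [c c_power_law] := choice (fun gj : nat * nat => power_law hnu hrho hdelta hexpansion
  (fun g x xr u => halpha g x u xr) hanalytic gj.1 gj.2).
exists (fun g j => c (g, j)) => g j; have [/= c0 alphaE] := c_power_law (g, j).
split=> // /c0 cgj; split=> // x x0 xr.
by rewrite alphaE// cgj mul0r.
Qed.
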